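(* Let $M$ be any two-dimensional smooth manifold. Then $M$ can be locally embedded in the complex projective plane and in the complex hyperbolic plane as a parallel mean curvature vector surface; that is, every point of $M$ has a neighbourhood $U$ which admits a smooth embedding into the complex projective plane, and also one into the complex hyperbolic plane, whose mean curvature vector is nonzero and parallel in the normal bundle.
   Context: The complex projective plane and the complex hyperbolic plane carry their Kaehler metrics of constant holomorphic sectional curvature $4\rho$, with $\rho>0$ and $\rho<0$ respectively. A parallel mean curvature vector surface is an immersed surface whose mean curvature vector field $H$ is parallel with respect to the normal connection. *)

(* Defs.v *)
From HB Require Import structures.
From mathcomp Require Import all_boot all_order all_algebra.
From mathcomp Require Import complex.
From mathcomp Require Import all_classical all_reals all_analysis.

Set Implicit Arguments.
Unset Strict Implicit.
Unset Printing Implicit Defensive.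

Import Order.TTheory GRing.Theory Num.Theory.
Import numFieldNormedType.Exports.

Local Open Scope classical_set_scope.
Local Open Scope ring_scope.

(** * Smooth maps between open sets of normed spaces *)

(* Meant for D open: then the total 'D_v f only looks at f near D. *)
Fixpoint Ck (R : realType) (V W : normedModType R) (k : nat)
    (D : set V) (f : V -> W) : Prop :=
  if k is k'.+1 then
    (forall x, D x -> differentiable f x) /\
    (forall v, Ck k' D (fun x => 'D_v f x))
  else forall x, D x -> {for x, continuous f}.

Definition smooth_on (R : realType) (V W : normedModType R)
    (D : set V) (f : V -> W) : Prop :=
  forall k, Ck k D f.

(** * Smooth manifolds *)

Record atlas (R : realType) (n : nat) (M : topologicalType) := Atlas {
  chart : Type;
  dom : chart -> set M;
  coord : chart -> M -> 'rV[R]_n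
}.

Section Manifolds.
Variable R : realType.

(* Inverse of a chart on its image; x0 is the junk value off the image. *)
Definition cinv n (M : topologicalType) (A : atlas R n M) (c : chart A)
    (x0 : M) (y : 'rV[R]_n) : M :=
  xget x0 [set x | dom c x /\ coord c x = y].

Definition smooth_manifold n (M : topologicalType) (A : atlas R n M) : Prop :=
  [/\ hausdorff_space M /\ second_countable (T := M),
      forall x : M, exists c : chart A, dom c x,
      forall c : chart A,
        [/\ open (dom c),
            {in dom c &, injective (coord c)} &
            forall V : set M, V `<=` dom c ->
              (open V <-> open (coord c @` V))] &
      forall (c d : chart A) (x0 : M),
        smooth_on (coord c @` (dom c `&` dom d))
                  (fun y => coord d (cinv c x0 y))].

Section Maps.
Variables (n m : nat) (M N : topologicalType).
Variables (A : atlas R n M) (B : atlas R m N).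
Implicit Types (f : M -> N) (U : set M).

Definition local_expr f (c : chart A) (d : chart B) (x0 : M) :
    'rV[R]_n -> 'rV[R]_m :=
  fun y => coord d (f (cinv c x0 y)).

Definition smooth_embedding U f : Prop :=
  [/\ {in U &, injective f},
      (forall x, U x -> {for x, continuous f}) /\
      (forall V, V `<=` U -> open V ->
         exists2 W : set N, open W & f @` V = W `&` f @` U),
      forall (c : chart A) (d : chart B) (x0 : M),
        smooth_on (coord c @` (U `&` dom c `&` f @^-1` dom d))
                  (local_expr f c d x0) &
      forall (c : chart A) (d : chart B) (x : M),
        U x -> dom c x -> dom d (f x) ->
        forall v, 'D_v (local_expr f c d x) (coord c x) = 0 -> v = 0].

End Maps.
End Manifolds.

(** * Submanifold geometry in a coordinate patch of a Riemannian manifold *)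

Section Geometry.
Variables (R : realType) (n m : nat).
(* G y is the Gram matrix of the Riemannian metric at y in the coordinate
   frame of the ambient patch, F a parametrized submanifold. *)
Variable G : 'rV[R]_m -> 'M[R]_m.
Variable F : 'rV[R]_n -> 'rV[R]_m.

Definition basis_vec k (i : 'I_k) : 'rV[R]_k := delta_mx 0 i.

Definition inner (y u v : 'rV[R]_m) : R := (u *m G y *m v^T) 0 0.

(* Christoffel symbols of the first kind:
   Gamma_{uv,l} = (d_u g_{vl} + d_v g_{ul} - d_l g_{uv}) / 2. *)
Definition christoffel1 (y u v : 'rV[R]_m) : 'rV[R]_m :=
  \row_l (2^-1 * ('D_u (fun q => inner q v (basis_vec l)) y
                  + 'D_v (fun q => inner q u (basis_vec l)) y
                  - 'D_(basis_vec l) (fun q => inner q u v) y)).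

Definition christoffel (y u v : 'rV[R]_m) : 'rV[R]_m :=
  christoffel1 y u v *m invmx (G y).

(* Levi-Civita covariant derivative, in the direction w, of a vector field X
   along F. *)
Definition covD (X : 'rV[R]_n -> 'rV[R]_m) (w x : 'rV[R]_n) : 'rV[R]_m :=
  'D_w X x + christoffel (F x) ('D_w F x) (X x).

Definition frame (i : 'I_n) (x : 'rV[R]_n) : 'rV[R]_m :=
  'D_(basis_vec i) F x.

Definition first_form (x : 'rV[R]_n) : 'M[R]_n :=
  \matrix_(i, j) inner (F x) (frame i x) (frame j x).

Definition tan_part (x : 'rV[R]_n) (V : 'rV[R]_m) : 'rV[R]_m :=
  \sum_i \sum_j (invmx (first_form x) i j * inner (F x) V (frame i x))
    *: frame j x.

Definition nor_part (x : 'rV[R]_n) (V : 'rV[R]_m) : 'rV[R]_m :=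
  V - tan_part x V.

Definition second_form (i j : 'I_n) (x : 'rV[R]_n) : 'rV[R]_m :=
  nor_part x (covD (frame j) (basis_vec i) x).

Definition mean_curvature (x : 'rV[R]_n) : 'rV[R]_m :=
  n%:R^-1 *: \sum_i \sum_j invmx (first_form x) i j *: second_form i j x.

Definition normal_conn (xi : 'rV[R]_n -> 'rV[R]_m) (w x : 'rV[R]_n) :
    'rV[R]_m :=
  nor_part x (covD xi w x).

End Geometry.

(* gB d is the Gram matrix of the metric of N in the chart d.  The mean
   curvature vector is required to be nonzero at every point of U. *)
Definition parallel_mean_curvature (R : realType) (n m : nat)
    (M N : topologicalType) (A : atlas R n M) (B : atlas R m N)
    (gB : chart B -> 'rV[R]_m -> 'M[R]_m) (U : set M) (f : M -> N) : Prop :=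
  forall (c : chart A) (d : chart B) (x : M),
    U x -> dom c x -> dom d (f x) ->
    let F := local_expr f c d x in
    let H := mean_curvature (gB d) F in
    H (coord c x) <> 0 /\
    forall w, normal_conn (gB d) F H w (coord c x) = 0.

Definition pmc_embedding (R : realType) (n m : nat)
    (M N : topologicalType) (A : atlas R n M) (B : atlas R m N)
    (gB : chart B -> 'rV[R]_m -> 'M[R]_m) (U : set M) (f : M -> N) : Prop :=
  smooth_embedding A B U f /\ parallel_mean_curvature A gB U f.

Arguments pmc_embedding {R n m M N} A B gB U f.

(** * The complex projective and hyperbolic planes *)

Definition Cplx (R : realType) : numClosedFieldType := R[i].

Definition CP2 (R : realType) : Type :=
  {L : {vspace 'rV[Cplx R]_3} | \dim L == 1%N}.

Section Projective.
Variable R : realType.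
Local Notation C := (Cplx R).
Local Notation CP2 := (CP2 R).

HB.instance Definition _ := Choice.on CP2.

Lemma dim_line_ones : \dim <[const_mx 1 : 'rV[C]_3]>%VS == 1%N.
Proof.
rewrite dim_vline; suff -> : const_mx 1 != 0 :> 'rV[C]_3 by [].
by apply/eqP => /matrixP/(_ 0 0)/eqP; rewrite !mxE oner_eq0.
Qed.

(* The point [z_0 : z_1 : z_2] (junk at z = 0). *)
Definition proj (z : 'rV[C]_3) : CP2 :=
  insubd (exist _ <[const_mx 1]>%VS dim_line_ones : CP2) <[z]>%VS.

(* Quotient topology of C^3 minus the origin. *)
Definition CP2_open : set_system CP2 :=
  [set W | open [set z : 'rV[C]_3 | z != 0 /\ W (proj z)]].

Lemma CP2_openT : CP2_open setT.
Proof.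
rewrite /CP2_open/=.
rewrite (_ : mkset _ = ~` [set 0]); last first.
  apply/seteqP; split=> z /=; first by case=> /eqP.
  by move=> /eqP.
by apply: closed_openC; apply: accessible_closed_set1;
   apply: hausdorff_accessible; exact: norm_hausdorff.
Qed.

Lemma CP2_openI : setI_closed CP2_open.
Proof.
move=> A B oA oB; rewrite /CP2_open/=.
rewrite (_ : mkset _ = [set z : 'rV[C]_3 | z != 0 /\ A (proj z)] `&`
                       [set z : 'rV[C]_3 | z != 0 /\ B (proj z)]).
  exact: openI.
by apply/seteqP; split=> z /= => [[? []]|[[? ?] []]].
Qed.

Lemma CP2_open_bigU (I : Type) (f : I -> set CP2) :
  (forall i, CP2_open (f i)) -> CP2_open (\bigcup_i f i).
Proof.
move=> of_; rewrite /CP2_open/=.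
rewrite (_ : mkset _ =
  \bigcup_i [set z : 'rV[C]_3 | z != 0 /\ f i (proj z)]).
  by apply: bigcup_open => i _; exact: of_.
apply/seteqP; split=> z /= => [[z0 [i _ fi]]|[i _ [z0 fi]]]; first by exists i.
by split=> //; exists i.
Qed.

HB.instance Definition _ :=
  isOpenTopological.Build CP2 CP2_openT CP2_openI CP2_open_bigU.

(* C^2 is identified with R^4 by w |-> (Re w_0, Re w_1, Im w_0, Im w_1). *)
Definition real_coord (w : 'rV[C]_2) : 'rV[R]_(2 + 2) :=
  row_mx (map_mx (@complex.Re R) w) (map_mx (@complex.Im R) w).

Definition cplx_coord (y : 'rV[R]_(2 + 2)) : 'rV[C]_2 :=
  \row_j Complex (lsubmx y 0 j) (rsubmx y 0 j).

Definition hom_coord (L : CP2) : 'rV[C]_3 := vpick (val L).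

(* Affine charts (z_j / z_k)_(j != k) on z_k != 0. *)
Definition CP2_dom (k : 'I_3) : set CP2 :=
  [set L | hom_coord L 0 k != 0].

Definition CP2_coord (k : 'I_3) (L : CP2) : 'rV[R]_(2 + 2) :=
  let z := hom_coord L in real_coord (col' k ((z 0 k)^-1 *: z)).

Definition CP2_atlas : atlas R (2 + 2) CP2 := Atlas CP2_dom CP2_coord.

(* Inserts a in position k; with a = 1 this is a section of the k-th chart,
   and with a = 0 the differential of that section. *)
Definition hom_lift (k : 'I_3) (a : C) (y : 'rV[R]_(2 + 2)) : 'rV[C]_3 :=
  \row_j oapp (fun i => cplx_coord y 0 i) a (unlift k j).

(* eps * z_0 conj(w_0) + z_1 conj(w_1) + z_2 conj(w_2), eps = 1 or -1. *)
Definition hform (eps : R) (z w : 'rV[C]_3) : C :=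
  \sum_j (if j == ord0 then Complex eps 0 else 1) * z 0 j * (w 0 j)^*.

(* For lifts u, v at z of two tangent vectors at [z], the metric is
   rho^-1 Re (<u, v><z, z> - <u, z><z, v>) / <z, z>^2.  In an affine chart with
   eps = 1 it is the Fubini-Study metric
     rho^-1 ((1 + |w|^2) |dw|^2 - |<dw, w>|^2) / (1 + |w|^2)^2,
   and in the chart z_0 = 1 with eps = -1 the Bergman metric of the unit ball
     |rho|^-1 ((1 - |w|^2) |dw|^2 + |<dw, w>|^2) / (1 - |w|^2)^2  (rho < 0);
   both have constant holomorphic sectional curvature 4 rho. *)
Definition hmetric (eps rho : R) (z u v : 'rV[C]_3) : R :=
  rho^-1 * complex.Re ((hform eps u v * hform eps z z
                        - hform eps u z * hform eps z v)
                       / hform eps z z ^+ 2).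

Definition affine_metric (eps rho : R) (k : 'I_3) (y : 'rV[R]_(2 + 2)) :
    'M[R]_(2 + 2) :=
  \matrix_(i, j) hmetric eps rho (hom_lift k 1 y)
    (hom_lift k 0 (delta_mx 0 i)) (hom_lift k 0 (delta_mx 0 j)).

Definition CP2_metric (rho : R) :
    chart CP2_atlas -> 'rV[R]_(2 + 2) -> 'M[R]_(2 + 2) :=
  affine_metric 1 rho.

(* CH^2: the lines on which - |z_0|^2 + |z_1|^2 + |z_2|^2 is negative, with
   the topology induced from CP^2. *)
Definition negative_lines : set CP2 :=
  [set L : CP2 | forall z : 'rV[C]_3,
     z \in (val L : {vspace 'rV[C]_3}) -> z != 0 -> hform (-1) z z < 0].

Definition CH2 : topologicalType := set_type negative_lines.

(* A single chart suffices: z_0 != 0 on negative lines, and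
   (z_1 / z_0, z_2 / z_0) ranges over the open unit ball. *)
Definition CH2_atlas : atlas R (2 + 2) CH2 :=
  Atlas (fun _ : unit => setT) (fun _ L => CP2_coord ord0 (set_val L)).

Definition CH2_metric (rho : R) :
    chart CH2_atlas -> 'rV[R]_(2 + 2) -> 'M[R]_(2 + 2) :=
  fun _ => affine_metric (-1) rho ord0.

End Projective.

Arguments CP2_metric {R} rho.
Arguments CH2_metric {R} rho.

(* Main.v *)
(** The homogeneous torus [r_0 : r_1 e^(i t_1) : r_2 e^(i t_2)] is Lagrangian and
    flat. In terms of the invariant frame T_1, T_2, the covariant derivatives of
    T_b along the torus are combinations with constant coefficients of the normal
    fields J T_c, and those of J T_c are tangent. So the mean curvature vector is a
    combination of the J T_c with constant coefficients, and it is parallel. It is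
    nonzero when the radii are suitably chosen: distinct in the projective plane,
    arbitrary in the hyperbolic plane. Composing a chart of M at a point with
    (t_1, t_2), restricted to a small ball, embeds a neighbourhood of that point as
    an open piece of such a torus. *)

Require Import Defs.
From mathcomp Require Import all_boot all_order all_algebra.
From mathcomp Require Import complex.
From mathcomp Require Import all_classical all_reals all_analysis.
From mathcomp Require Import ring lra.

Import Defs.

Set Implicit Arguments.
Unset Strict Implicit.
Unset Printing Implicit Defensive.

Import Order.TTheory GRing.Theory Num.Theory.
Import numFieldNormedType.Exports.

Local Open Scope classical_set_scope.
Local Open Scope ring_scope.

(** * Differential calculus of [Ck] maps on open sets *)

Section Calculus.
Variable R : realType.
Implicit Types V W : normedModType R.

(** The mean curvature condition is required in every chart of [M] and every chart of the target, so
    no convenient coordinates can be fixed. Two facts remove this dependence. In the affine chart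
    that divides by the k-th homogeneous coordinate, the torus is again a product of two circles,
    with radii [r j / r k] and with angles taken relative to the k-th one. In a chart of [M], the
    angles are some smooth function [al] with injective differential; its Jacobian cancels when the
    second fundamental form is contracted with the inverse first form, and its second derivatives
    contribute only tangent vectors. What remains is algebra with constant 2 by 2 matrices. Both
    planes are handled by one computation with a sign [eps]. In affine coordinates the normal
    vectors are [tvec a V] and the tangent vectors are [cj (tvec a V)], so tangent and normal parts
    are told apart by counting factors i in a complex bilinear connection. *)

Lemma near_eq_differentiable V W (f g : V -> W) x :
  (\near x, f x = g x) -> differentiable f x -> differentiable g x.
Proof.
move=> fg df; have gx : f x = g x := nbhs_singleton fg.
have cd := diff_continuous df.
have e : g \o shift x = cst (g x) + 'd f x +o_ 0 id.
  apply/eqaddoP => eps eps0.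
  have /diff_locallyP[_ /eqaddoP/(_ _ eps0)] := df.
  move: fg; rewrite (near_shift 0 x) => fg.
  apply: filterS2 fg => h /=; rewrite subr0 => fgh.
  by rewrite !fctE /= fgh gx.
by apply/diff_locallyP; rewrite (diff_unique cd e).
Qed.

Lemma open_near V (D : set V) (P : V -> Prop) x :
  open D -> (forall y, D y -> P y) -> D x -> \near x, P x.
Proof.
move=> oD DP Dx; apply: filterS DP _.
exact: open_nbhs_nbhs.
Qed.

Lemma open_eq_derive V W (D : set V) (f g : V -> W) x v :
  open D -> (forall y, D y -> f y = g y) -> D x -> 'D_v f x = 'D_v g x.
Proof. by move=> oD fg Dx; apply: near_eq_derive; exact: open_near Dx. Qed.

Lemma Ck_derivable V W k (D : set V) (f : V -> W) x v :
  Ck k.+1 D f -> D x -> derivable f x v.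
Proof. by move=> [+ _] Dx => /(_ _ Dx) /diff_derivable. Qed.

(** [Ck] refers to total derivatives, but at a point of an open [D] these see only the values on
    [D], so equality passes to the derivatives. This is what makes the junk values of chart inverses
    harmless. *)
Lemma eq_Ck V W k (D : set V) (f g : V -> W) :
  open D -> (forall y, D y -> f y = g y) -> Ck k D f -> Ck k D g.
Proof.
move=> oD; elim: k f g => [|k IHk] f g fg /=.
  move=> Cf x Dx; have Cfx : f @ x --> g x by rewrite -fg//; exact: Cf.
  by apply: cvg_trans Cfx; apply: near_eq_cvg; exact: open_near Dx.
move=> [df Cf]; split=> [x Dx|v].
  by apply: near_eq_differentiable (df x Dx); exact: open_near Dx.
by apply: IHk (Cf v) => y Dy; exact: open_eq_derive Dy.
Qed.

Lemma CkW V W k (D : set V) (f : V -> W) : Ck k.+1 D f -> Ck k D f.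
Proof.
elim: k f => [|k IHk] f [df Df].
  by move=> x Dx; apply: differentiable_continuous; exact: df.
by split=> // v; apply: IHk; exact: Df.
Qed.

Lemma Ck_cst V W k (D : set V) (w : W) : Ck k D (cst w).
Proof.
elim: k w => [|k IHk] w; first by move=> x _; exact: cst_continuous.
split=> [x _|v]; first exact: differentiable_cst.
rewrite (_ : (fun x => _) = cst 0); first exact: IHk.
by apply/funext => x; rewrite derive_cst.
Qed.

Section OnOpen.
Variables (V : normedModType R) (D : set V).
Hypothesis oD : open D.

Lemma CkD W k (f g : V -> W) : Ck k D f -> Ck k D g -> Ck k D (f + g).
Proof.
elim: k f g => [|k IHk] f g.
  by move=> Cf Cg x Dx; apply: continuousD; [exact: Cf|exact: Cg].
move=> Cf Cg; have [[df Df] [dg Dg]] := (Cf, Cg); split=> [x Dx|v].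
  by apply: differentiableD; [exact: df|exact: dg].
apply: (eq_Ck oD _ (IHk _ _ (Df v) (Dg v))) => y Dy /=.
by rewrite deriveD//; [exact: Ck_derivable Cf _|exact: Ck_derivable Cg _].
Qed.

Lemma CkM k (f g : V -> R) : Ck k D f -> Ck k D g -> Ck k D (f * g).
Proof.
elim: k f g => [|k IHk] f g.
  by move=> Cf Cg x Dx; apply: continuousM; [exact: Cf|exact: Cg].
move=> Cf Cg; have [[df Df] [dg Dg]] := (Cf, Cg); split=> [x Dx|v].
  by apply: differentiableM; [exact: df|exact: dg].
apply: (eq_Ck oD _ (CkD (IHk _ _ (CkW Cf) (Dg v)) (IHk _ _ (CkW Cg) (Df v)))).
move=> y Dy /=.
by rewrite deriveM//; [exact: Ck_derivable Cf _|exact: Ck_derivable Cg _].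
Qed.

Lemma deriveZl W (f : V -> R) (w : W) x v :
  differentiable f x -> 'D_v (fun y => f y *: w) x = 'D_v f x *: w.
Proof.
by move=> df; rewrite !deriveE ?diffZl//; exact: differentiableZl.
Qed.

Lemma CkZl W k (f : V -> R) (w : W) : Ck k D f -> Ck k D (fun x => f x *: w).
Proof.
elim: k f => [|k IHk] f.
  by move=> Cf x Dx; apply: continuousZr_tmp; exact: Cf.
move=> [df Df]; split=> [x Dx|v].
  by apply: differentiableZl; exact: df.
apply: (eq_Ck oD _ (IHk _ (Df v))) => y Dy.
by rewrite deriveZl//; exact: df.
Qed.

Lemma derive_coord n (f : V -> 'rV[R]_n) a x v :
  differentiable f x -> 'D_v (fun y => f y 0 a) x = ('D_v f x) 0 a.
Proof. by move=> /diff_derivable df; rewrite (derive_mx (df v)) mxE. Qed.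

Lemma Ck_coord n k (f : V -> 'rV[R]_n) a : Ck k D f -> Ck k D (fun x => f x 0 a).
Proof.
elim: k f => [|k IHk] f.
  move=> Cf x Dx; apply: (@continuous_comp _ _ _ f (fun M : 'rV_n => M 0 a)).
    exact: Cf.
  exact: coord_continuous.
move=> [df Df]; split=> [x Dx|v].
  apply: (@differentiable_comp _ _ _ _ f (fun M : 'rV_n => M 0 a)).
    exact: df.
  exact: differentiable_coord.
apply: (eq_Ck oD _ (IHk _ (Df v))) => y Dy.
by rewrite derive_coord//; exact: df.
Qed.

Lemma is_derive_comp1 (g : R -> R) (f : V -> R) x v dg :
  differentiable f x -> is_derive (f x) 1 g dg ->
  is_derive x v (g \o f) (dg * 'D_v f x).
Proof.
move=> df [/derivable1_diffP dg' dgE].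
have dc : differentiable (g \o f) x by exact: differentiable_comp.
apply: DeriveDef; first exact: diff_derivable.
rewrite deriveE// diff_comp//= -dgE deriveE//.
rewrite deriveE// -[in LHS](mulr1 ('d f x v)) -[_ * 1]/(_ *: (1 : R)).
by rewrite linearZ/= mulrC.
Qed.

(** Joint induction, because the derivative of each function calls for the other one at the previous
    order. *)
Lemma Ck_trig k (f : V -> R) : Ck k D f -> Ck k D (cos \o f) /\ Ck k D (sin \o f).
Proof.
elim: k f => [|k IHk] f.
  move=> Cf; split=> x Dx; apply: continuous_comp.
  - exact: Cf.
  - exact: continuous_cos.
  - exact: Cf.
  - exact: continuous_sin.
move=> Cf; have [df Df] := Cf.
have [Ccos Csin] := IHk _ (CkW Cf).
split; (split=> [x Dx|v]).
- apply: differentiable_comp; first exact: df.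
  by apply/derivable1_diffP; exact: derivable_cos.
- have C := CkM (CkM (Ck_cst k D (-1 : R)) Csin) (Df v).
  apply: (eq_Ck oD _ C) => y Dy.
  rewrite (@derive_val _ _ _ _ _ _ _ (is_derive_comp1 _ (df y Dy) (is_derive_cos _))).
  by rewrite !fctE/= mulN1r.
- apply: differentiable_comp; first exact: df.
  by apply/derivable1_diffP; exact: derivable_sin.
- have C := CkM Ccos (Df v).
  apply: (eq_Ck oD _ C) => y Dy.
  by rewrite (@derive_val _ _ _ _ _ _ _ (is_derive_comp1 _ (df y Dy) (is_derive_sin _))).
Qed.

End OnOpen.
End Calculus.

(** * The complex structure on real coordinates *)

Section ComplexStructure.
Variable R : realType.
Implicit Types (u v w q : 'rV[R]_(2 + 2)).

Definition dot n (u v : 'rV[R]_n) : R := (u *m v^T) 0 0.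

(* Multiplication by i on C^2 = R^4. *)
Definition cj u : 'rV[R]_(2 + 2) := row_mx (- rsubmx u) (lsubmx u).

Lemma dotE n (u v : 'rV[R]_n) : dot u v = \sum_i u 0 i * v 0 i.
Proof. by rewrite /dot mxE; apply: eq_bigr => i _; rewrite mxE. Qed.

Lemma dotC n (u v : 'rV[R]_n) : dot u v = dot v u.
Proof. by rewrite !dotE; apply: eq_bigr => i _; rewrite mulrC. Qed.

Lemma dotDl n (u v w : 'rV[R]_n) : dot (u + v) w = dot u w + dot v w.
Proof. by rewrite /dot mulmxDl mxE. Qed.

Lemma dotZl n a (u v : 'rV[R]_n) : dot (a *: u) v = a * dot u v.
Proof. by rewrite /dot -scalemxAl mxE. Qed.

Lemma dotNl n (u v : 'rV[R]_n) : dot (- u) v = - dot u v.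
Proof. by rewrite -scaleN1r dotZl mulN1r. Qed.

Lemma dotNr n (u v : 'rV[R]_n) : dot v (- u) = - dot v u.
Proof. by rewrite dotC dotNl (dotC v). Qed.

Lemma dot_split u v :
  dot u v = dot (lsubmx u) (lsubmx v) + dot (rsubmx u) (rsubmx v).
Proof.
by rewrite -[u in LHS]hsubmxK -[v in LHS]hsubmxK /dot tr_row_mx mul_row_col mxE.
Qed.

Lemma dot_row (a b c d : 'rV[R]_2) :
  dot (row_mx a b : 'rV_(2 + 2)) (row_mx c d) = dot a c + dot b d.
Proof. by rewrite dot_split !row_mxKl !row_mxKr. Qed.

Lemma cjD u v : cj (u + v) = cj u + cj v.
Proof. by rewrite /cj !linearD/= add_row_mx. Qed.

Lemma cjZ a u : cj (a *: u) = a *: cj u.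
Proof. by rewrite /cj !linearZ/= scale_row_mx. Qed.

Lemma cjN u : cj (- u) = - cj u.
Proof. by rewrite -scaleN1r cjZ scaleN1r. Qed.

Lemma cjK u : cj (cj u) = - u.
Proof. by rewrite /cj row_mxKl row_mxKr -opp_row_mx hsubmxK. Qed.

Lemma cj_dot u v : dot (cj u) (cj v) = dot u v.
Proof. by rewrite dot_row dotNl dotNr opprK addrC -dot_split. Qed.

Lemma cj_dotl u v : dot (cj u) v = - dot u (cj v).
Proof. by rewrite -cj_dot cjK dotNl. Qed.

Lemma dot_cj0 u : dot u (cj u) = 0.
Proof. by have := cj_dotl u u; rewrite dotC; lra. Qed.

End ComplexStructure.

(** * The ambient metric in an affine chart *)

Section AffineMetric.
Variable R : realType.
Implicit Types (u v w q y : 'rV[R]_(2 + 2)).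
Local Notation C := (Cplx R).

Lemma conj_Complex (a b : R) : (Complex a b : C)^* = Complex a (- b).
Proof. by []. Qed.

Lemma mul_Complex (a b c d : R) :
  (Complex a b : C) * Complex c d = Complex (a * c - b * d) (a * d + b * c).
Proof. by []. Qed.

Lemma add_Complex (a b c d : R) :
  (Complex a b : C) + Complex c d = Complex (a + c) (b + d).
Proof. by []. Qed.

(** The sign [eps] sits on the homogeneous coordinate 0. For [k = 0] this is the inserted
    coordinate, and for [eps = 1] its place is immaterial; in both cases the affine coordinates
    contribute the standard Hermitian product. *)
Lemma hform_hom_lift eps (k : 'I_3) (a b : C) y y' : eps = 1 \/ k = 0 ->
  hform eps (hom_lift k a y) (hom_lift k b y') =
  Complex eps 0 * a * b^* + Complex (dot y y') (dot y (cj y')).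
Proof.
move=> epsk; rewrite /hform (bigD1_ord k)//= !mxE !unlift_none/=; congr (_ + _).
  congr (_ * _ * _); case: epsk => [->|->//]; by case: ifP.
transitivity (\sum_i cplx_coord y 0 i * (cplx_coord y' 0 i)^*).
  apply: eq_bigr => i _; rewrite !mxE !liftK/= !mxE; congr (_ * _).
  rewrite -[RHS]mul1r; congr (_ * _); case: epsk => [->|->//]; by case: ifP.
rewrite dot_split dot_split row_mxKl row_mxKr !dotE.
rewrite !big_ord_recl !big_ord0 !mxE !conj_Complex !mul_Complex !add_Complex !addr0.
by congr Complex; ring.
Qed.

Lemma Re_mul_real (z : C) (a : R) : complex.Re (z * a%:C%C) = complex.Re z * a.
Proof. by case: z => x y /=; rewrite mulr0 subr0. Qed.

(** The Hermitian form on the section of the chart; the logarithm of its absolute value is a Kaehler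
    potential of the metric up to a constant factor. *)
Definition kform eps q : R := eps + dot q q.

Lemma hmetric_hom_lift eps rho (k : 'I_3) q u v : eps = 1 \/ k = 0 ->
  hmetric eps rho (hom_lift k 1 q) (hom_lift k 0 u) (hom_lift k 0 v) =
  (rho * kform eps q ^+ 2)^-1 *
    (kform eps q * dot u v - dot u q * dot v q - dot u (cj q) * dot v (cj q)).
Proof.
move=> epsk; rewrite /hmetric.
have -> : hform eps (hom_lift k 1 q) (hom_lift k 1 q) = (kform eps q)%:C%C.
  by rewrite hform_hom_lift// rmorph1 !mulr1 add_Complex dot_cj0 addr0.
rewrite -rmorphXn -fmorphV Re_mul_real.
rewrite !hform_hom_lift// !(mulr0, mul0r, add0r, rmorph0) /=.
rewrite mulr0 subr0 [(rho * _)^-1]invfM -[RHS]mulrA; congr (_ * _).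
rewrite mulrC; congr (_ * _).
have -> : dot q (cj v) = - dot v (cj q) by rewrite (dotC v) cj_dotl opprK.
by rewrite (dotC q v); ring.
Qed.

Lemma dot_deltal n (i : 'I_n) (v : 'rV[R]_n) : dot (delta_mx 0 i) v = v 0 i.
Proof. by rewrite /dot -rowE !mxE. Qed.

Lemma inner_affine eps rho (k : 'I_3) q u v : eps = 1 \/ k = 0 ->
  inner (affine_metric eps rho k) q u v =
  (rho * kform eps q ^+ 2)^-1 *
    (kform eps q * dot u v - dot u q * dot v q - dot u (cj q) * dot v (cj q)).
Proof.
move=> epsk; rewrite /inner.
(* A scalar matrix minus two rank-one matrices, which come from the real and the imaginary part of
   [<u, q>]. *)
have -> : affine_metric eps rho k q = (rho * kform eps q ^+ 2)^-1 *:
    ((kform eps q)%:M - q^T *m q - (cj q)^T *m cj q).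
  apply/matrixP => i j; rewrite !mxE hmetric_hom_lift//; congr (_ * _).
  by rewrite !big_ord1 !mxE !dot_deltal !mxE eqxx/= mulr_natr.
rewrite -scalemxAr -scalemxAl mxE !mulmxBr !mulmxBl mul_mx_scalar.
rewrite -scalemxAl; congr (_ * _).
have sub00 (A B : 'M[R]_1) : (A - B) 0 0 = A 0 0 - B 0 0 by rewrite !mxE.
have out00 a b : (u *m (a^T *m b) *m v^T) 0 0 = dot u a * dot v b.
  by rewrite mulmxA -mulmxA mxE big_ord1 (dotC v).
by rewrite !sub00 !out00 [X in X - _ - _]mxE.
Qed.

End AffineMetric.

(** * The Levi-Civita connection in an affine chart *)

Section Christoffel.
Variable R : realType.
Implicit Types (a b u v w q : 'rV[R]_(2 + 2)).

Global Instance is_derive_dot n (a x w : 'rV[R]_n) :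
  is_derive x w (dot a) (dot a w).
Proof.
rewrite (dotE a w).
have -> : dot a = \sum_i (a 0 i \*: (fun q : 'rV[R]_n => q 0 i)).
  by apply/funext => q; rewrite dotE fct_sumE.
apply: is_derive_sum => i.
have D : is_derive x w (fun q : 'rV[R]_n => q 0 i) (w 0 i).
  apply: DeriveDef; first by apply/diff_derivable/differentiable_coord.
  by rewrite (@derive_coord _ _ _ id)// derive_id.
exact: is_deriveZ.
Qed.

Global Instance is_derive_dotqq n (x w : 'rV[R]_n) :
  is_derive x w (fun q : 'rV[R]_n => dot q q) (2 * dot w x).
Proof.
have -> : (fun q : 'rV[R]_n => dot q q) =
    \sum_i ((fun q : 'rV[R]_n => q 0 i) * (fun q : 'rV[R]_n => q 0 i)).
  by apply/funext => q; rewrite dotE fct_sumE.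
have D i : is_derive x w (fun q : 'rV[R]_n => q 0 i) (w 0 i).
  apply: DeriveDef; first by apply/diff_derivable/differentiable_coord.
  by rewrite (@derive_coord _ _ _ id)// derive_id.
apply: is_derive_eq; rewrite dotE mulr_sumr; apply: eq_bigr => i _.
by rewrite /GRing.scale/=; ring.
Qed.

Section Metric.
Variables (eps rho : R) (k : 'I_3).
Hypothesis epsk : eps = 1 \/ k = 0.
Local Notation G := (affine_metric eps rho k).
Local Notation N := (kform eps).

(** Here [cj] acts on the fixed vectors and not on the point, so each factor is [N] or linear in [q]
    and can be differentiated directly. *)
Definition kherm q a b : R :=
  N q * dot a b - dot a q * dot b q - dot (cj a) q * dot (cj b) q.

Lemma innerE q a b : inner G q a b = (rho * N q ^+ 2)^-1 * kherm q a b.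
Proof. by rewrite inner_affine// /kherm !(cj_dotl _ q) mulrNN. Qed.

Lemma is_derive_kform (x w : 'rV[R]_(2 + 2)) : is_derive x w N (2 * dot w x).
Proof.
have -> : N = cst eps + (fun q => dot q q) by [].
by apply: is_derive_eq; rewrite add0r.
Qed.

Lemma derive_inner (x w : 'rV[R]_(2 + 2)) a b : rho != 0 -> N x != 0 ->
  'D_w (fun q => inner G q a b) x =
  (rho * N x ^+ 2)^-1 * (2 * dot w x * dot a b
    - dot a w * dot b x - dot a x * dot b w
    - dot (cj a) w * dot (cj b) x - dot (cj a) x * dot (cj b) w
    - 4 * dot w x / N x * kherm x a b).
Proof.
move=> rho0 Nx0.
have DN := is_derive_kform x w.
pose P : 'rV[R]_(2 + 2) -> R := rho \*: (N ^+ 2).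
pose K : 'rV[R]_(2 + 2) -> R := dot a b \*: N - dot a * dot b - dot (cj a) * dot (cj b).
have -> : (fun q => inner G q a b) = (fun q => (P q)^-1) * K.
  apply/funext => q; rewrite innerE /kherm /P /K !fctE /=.
  by rewrite (mulrC (N q)).
have [DP1 DP2] : is_derive x w P (rho * (2 * N x * (2 * dot w x))).
  by apply: is_derive_eq; rewrite /GRing.scale/= expr1; ring.
have [DK1 DK2] : is_derive x w K (2 * dot w x * dot a b
    - dot a w * dot b x - dot a x * dot b w
    - dot (cj a) w * dot (cj b) x - dot (cj a) x * dot (cj b) w).
  by apply: is_derive_eq; rewrite /GRing.scale/=; ring.
have P0 : P x != 0.
  by rewrite -[P x]/(rho * N x ^+ 2) mulf_neq0// expf_neq0.
rewrite (deriveM (derivableV P0 DP1) DK1) (deriveV P0 DP1) DP2 DK2 /GRing.scale/= /P /K !fctE/=.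
rewrite /kherm /GRing.scale/=; move: Nx0 rho0; move: (N x) => n n0 r0.
by field; rewrite n0 r0.
Qed.

Hypothesis eps2 : eps ^+ 2 = 1.
Hypothesis rho0 : rho != 0.

Lemma affine_metric_unit q : N q != 0 -> G q \in unitmx.
Proof.
move=> Nq0; rewrite -row_free_unit; apply: inj_row_free => u uG.
have Ku v : kherm q u v = 0.
  have := innerE q u v; rewrite /inner uG mul0mx mxE => /esym/eqP.
  by rewrite mulf_eq0 invr_eq0 mulf_eq0 expf_eq0 (negbTE rho0) (negbTE Nq0) => /eqP.
have e0 : eps != 0.
  apply: contra_eq_neq eps2 => ->; rewrite expr0n/= eq_sym; exact: oner_neq0.
have uq : dot u q = 0.
  have := Ku q; rewrite /kherm (dotC (cj q)) dot_cj0 mulr0 subr0 => E.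
  by apply: (mulfI e0); rewrite mulr0 -[RHS]E /kform; ring.
have ucq : dot (cj u) q = 0.
  have := Ku (cj q).
  rewrite /kherm uq mul0r subr0 cjK dotNl -[dot u (cj q)]opprK -cj_dotl => E.
  by apply: (mulfI e0); rewrite mulr0; apply/eqP; rewrite -oppr_eq0 -[X in _ == X]E /kform; apply/eqP; ring.
have := Ku u; rewrite /kherm uq ucq !mul0r !subr0 => /eqP.
rewrite mulf_eq0 (negbTE Nq0)/= dotE psumr_eq0 => [/allP u0|i _]; last first.
  by rewrite -expr2 sqr_ge0.
apply/rowP => i; rewrite mxE; apply/eqP.
by have := u0 i; rewrite mem_index_enum mulf_eq0 orbb; apply.
Qed.

(* The Christoffel symbols of a Kaehler metric are complex bilinear; in complex
   notation this is - (<u, q> v + <v, q> u) / N. *)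
Lemma christoffel_affine q u v : N q != 0 ->
  christoffel G q u v = - (N q)^-1 *:
    (dot u q *: v + dot v q *: u - dot (cj u) q *: cj v - dot (cj v) q *: cj u).
Proof.
move=> Nq0; rewrite /christoffel; set W := RHS.
(* Multiplying the candidate by [G q] avoids computing the inverse matrix and leaves a rational
   identity. *)
suff -> : christoffel1 G q u v = W *m G q by rewrite mulmxK// affine_metric_unit.
apply/rowP => l.
have -> : (W *m G q) 0 l = inner G q W (basis_vec R l).
  by rewrite /inner -/(dot _ _) dotC dot_deltal.
rewrite mxE !derive_inner//; set e := basis_vec R l.
rewrite innerE /kherm /W; clearbody e => {W}.
rewrite !(cjZ, cjD, cjN, cjK) !(dotZl, dotDl, dotNl).

rewrite (dotC v u) (dotC e u) (dotC e v).
have anti a b : dot (cj a) b = - dot (cj b) a by rewrite cj_dotl dotC.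
rewrite (anti v u) (anti e u) (anti e v).
by move: (N q) Nq0 => n n0; field; rewrite n0 rho0.
Qed.

End Metric.
End Christoffel.

(** * Vector fields along a product torus *)

Section Torus.
Variable R : realType.
Implicit Types (a V W eta : 'rV[R]_2).

Lemma is_derive_rV (U : normedModType R) n (f : U -> 'rV[R]_n) x w (df : 'rV[R]_n) :
  (forall j, is_derive x w (fun q => f q 0 j) (df 0 j)) -> is_derive x w f df.
Proof.
move=> D.
have df1 : derivable f x w by apply/derivable_mxP => i j; rewrite ord1; have [] := D j.
apply: DeriveDef => //; rewrite derive_mx//; apply/rowP => j; rewrite !mxE.
by have [] := D j.
Qed.

Lemma cj_lshift (u : 'rV[R]_(2 + 2)) b : cj u 0 (lshift 2 b) = - u 0 (rshift 2 b).
Proof. by rewrite row_mxEl !mxE. Qed.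

Lemma cj_rshift (u : 'rV[R]_(2 + 2)) b : cj u 0 (rshift 2 b) = u 0 (lshift 2 b).
Proof. by rewrite row_mxEr !mxE. Qed.

Lemma is_derive_cj (U : normedModType R) (f : U -> 'rV[R]_(2 + 2)) x w df :
  is_derive x w f df -> is_derive x w (fun q => cj (f q)) (cj df).
Proof.
move=> [fx dfE].
have D j : is_derive x w (fun q => f q 0 j) (df 0 j).
  move/derivable_mxP : (fx) => fj.
  by apply: DeriveDef => //; rewrite -dfE derive_mx// mxE.
apply: is_derive_rV => j; case: (split_ordP j) => b ->.
  rewrite (_ : (fun q => _) = - (fun q => f q 0 (rshift 2 b))).
    rewrite cj_lshift.
    exact: is_deriveN.
  by apply/funext => q; rewrite cj_lshift.
rewrite (_ : (fun q => _) = (fun q => f q 0 (lshift 2 b))).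
  rewrite cj_rshift.
  exact: D.
by apply/funext => q; rewrite cj_rshift.
Qed.

Section Frame.
Variable s : 'I_2 -> R.

Definition pw V W : 'rV[R]_2 := \row_b (V 0 b * W 0 b).

(* With V = (1, 1) this is the point of the torus with angles a; applying [cj]
   gives the tangent vector at that point with angular velocity V. *)
Definition tvec a V : 'rV[R]_(2 + 2) :=
  row_mx (\row_b (V 0 b * (s b * cos (a 0 b)))) (\row_b (V 0 b * (s b * sin (a 0 b)))).

(** The inner product of the velocity [cj (tvec a V)] with [cj] of the position. It does not depend
    on the angles, which is why the Christoffel terms have constant coefficients. *)
Definition moment V : R := \sum_b V 0 b * s b ^+ 2.

Lemma tvec_lshift a V b : tvec a V 0 (lshift 2 b) = V 0 b * (s b * cos (a 0 b)).
Proof. by rewrite row_mxEl mxE. Qed.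

Lemma tvec_rshift a V b : tvec a V 0 (rshift 2 b) = V 0 b * (s b * sin (a 0 b)).
Proof. by rewrite row_mxEr mxE. Qed.

Lemma tvecD a V W : tvec a (V + W) = tvec a V + tvec a W.
Proof.
by rewrite /tvec add_row_mx; congr row_mx; apply/rowP => b; rewrite !mxE mulrDl.
Qed.

Lemma tvecZ a c V : tvec a (c *: V) = c *: tvec a V.
Proof.
by rewrite /tvec scale_row_mx; congr row_mx; apply/rowP => b; rewrite !mxE -mulrA.
Qed.

Lemma tvecN a V : tvec a (- V) = - tvec a V.
Proof. by rewrite -scaleN1r tvecZ scaleN1r. Qed.

Lemma tvec_sum a (I : finType) (f : I -> 'rV[R]_2) :
  tvec a (\sum_i f i) = \sum_i tvec a (f i).
Proof.
apply: (big_morph (tvec a) (tvecD a)).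
by rewrite -[X in tvec _ X](scale0r (0 : 'rV_2)) tvecZ scale0r.
Qed.

Lemma dot_tvec a V W : dot (tvec a V) (tvec a W) = \sum_b V 0 b * W 0 b * s b ^+ 2.
Proof.
rewrite dot_row !dotE -big_split/=; apply: eq_bigr => b _; rewrite !mxE.
by rewrite -[RHS]mulr1 -(cos2Dsin2 (a 0 b)); ring.
Qed.

(** For fixed angles the vectors [tvec a V] lie in a rotated copy of the real plane, on which the
    Hermitian product takes real values. *)
Lemma dot_cj_tvec a V W : dot (cj (tvec a V)) (tvec a W) = 0.
Proof.
rewrite dot_row row_mxKl row_mxKr !dotE -big_split/=; apply: big1 => b _; rewrite !mxE.
by ring.
Qed.

Lemma dot_tvec1 a V : dot (tvec a V) (tvec a (const_mx 1)) = moment V.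
Proof. by rewrite dot_tvec; apply: eq_bigr => b _; rewrite mxE mulr1. Qed.

(** Varying [V] stays in the real plane of the angles, while varying the angles multiplies by i;
    hence one term without [cj] and one with it. *)
Lemma is_derive_tvec (U : normedModType R) (al V : U -> 'rV[R]_2) x w :
  differentiable al x -> differentiable V x ->
  is_derive x w (fun q => tvec (al q) (V q))
    (tvec (al x) ('D_w V x) + cj (tvec (al x) (pw (V x) ('D_w al x)))).
Proof.
move=> dal dV.
have Dal b : 'D_w (fun q => al q 0 b) x = ('D_w al x) 0 b by rewrite derive_coord.
have dalb b : differentiable (fun q => al q 0 b : R) x.
  by apply: (@differentiable_comp _ _ _ _ al (fun M : 'rV_2 => M 0 b))=> //; exact: differentiable_coord.
have DV b : is_derive x w (fun q => V q 0 b : R) (('D_w V x) 0 b).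
  apply: DeriveDef; last by rewrite derive_coord.
  apply: diff_derivable.
  by apply: (@differentiable_comp _ _ _ _ V (fun M : 'rV_2 => M 0 b))=> //; exact: differentiable_coord.
have Dcos b := is_derive_comp1 w (dalb b) (is_derive_cos (al x 0 b)).
have Dsin b := is_derive_comp1 w (dalb b) (is_derive_sin (al x 0 b)).
apply: is_derive_rV => j; case: (split_ordP j) => b ->.
  rewrite (_ : (fun q => _) = (fun q => V q 0 b) * (s b \*: (cos \o (fun q => al q 0 b)))).
    apply: is_derive_eq; rewrite mxE tvec_lshift cj_lshift tvec_rshift mxE Dal /GRing.scale/= /GRing.scale/=.
    by ring.
  by apply/funext => q; rewrite tvec_lshift.
rewrite (_ : (fun q => _) = (fun q => V q 0 b) * (s b \*: (sin \o (fun q => al q 0 b)))).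
  apply: is_derive_eq; rewrite mxE tvec_rshift cj_rshift tvec_lshift mxE Dal /GRing.scale/= /GRing.scale/=.
  by ring.
by apply/funext => q; rewrite tvec_rshift.
Qed.

End Frame.
End Torus.

(** * Induced metric and Christoffel symbols along the torus *)

Section TorusGeometry.
Variable R : realType.
Implicit Types (a V W : 'rV[R]_2).

Lemma invmx_uniq n (A B : 'M[R]_n) : A *m B = 1%:M -> invmx A = B.
Proof.
by move=> AB; have [uA _] := mulmx1_unit AB; rewrite -[RHS](mulKmx uA) AB mulmx1.
Qed.

Lemma ord2_ind (P : 'I_2 -> Prop) : P 0 -> P 1 -> forall i, P i.
Proof.
move=> P0 P1 [[|[|//]] i]; first by rewrite (_ : Ordinal i = 0)//; exact/val_inj.
by rewrite (_ : Ordinal i = 1)//; exact/val_inj.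
Qed.

Lemma sum2 (V : nmodType) (F : 'I_2 -> V) : \sum_i F i = F 0 + F 1.
Proof.
by rewrite !big_ord_recl big_ord0 addr0; congr (_ + F _); exact/val_inj.
Qed.

Section Torus.
Variables (s : 'I_2 -> R) (eps rho : R) (k : 'I_3).
Hypothesis epsk : eps = 1 \/ k = 0.
Hypothesis eps2 : eps ^+ 2 = 1.
Hypothesis rho0 : rho != 0.
Hypothesis s0 : forall b, s b != 0.
Local Notation N := (eps + \sum_b s b ^+ 2).
Hypothesis N0 : N != 0.
Local Notation G := (affine_metric eps rho k).
Local Notation tv := (tvec s).
Local Notation pt a := (tv a (const_mx 1)).
Local Notation mom := (moment s).

Lemma kform_torus a : kform eps (pt a) = N.
Proof.
by rewrite /kform dot_tvec1; congr (_ + _); apply: eq_bigr => b _; rewrite mxE mul1r.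
Qed.

Definition torus_gram : 'M[R]_2 := \matrix_(b, c)
  ((rho * N ^+ 2)^-1 * (N * (s b ^+ 2 *+ (b == c)) - s b ^+ 2 * s c ^+ 2)).

(* Inverse of the rank one perturbation [torus_gram] of a diagonal matrix, by the
   Sherman-Morrison formula. *)
Definition torus_cogram : 'M[R]_2 := \matrix_(b, c)
  (rho * N * ((s b ^+ 2)^-1 *+ (b == c) + eps)).

Lemma torus_gramK : torus_gram *m torus_cogram = 1%:M.
Proof.
(* The Sherman-Morrison denominator is [N - \sum_b s b ^+ 2 = eps], which is its own inverse; this
   is the entry [eps] of [torus_cogram]. *)
have [e|e] : eps = 1 \/ eps = -1.
  by move/eqP : eps2; rewrite sqrf_eq1 => /orP[] /eqP ->; [left|right].
all: apply/matrixP; apply: ord2_ind; apply: ord2_ind; rewrite !mxE sum2 !mxE sum2/=.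
all: move: N0 (s0 0) (s0 1); rewrite sum2 e => D x0 y0.
all: by field; rewrite D x0 y0 rho0.
Qed.

Lemma inner_torus a V W : inner G (pt a) (cj (tv a V)) (cj (tv a W)) =
  (V *m torus_gram *m W^T) 0 0.
Proof.
rewrite innerE// /kherm kform_torus !cj_dot !dot_cj_tvec !cjK !dotNl mulrNN mulr0 subr0.
rewrite /torus_gram; set r := (rho * _)^-1; set n := eps + _; clearbody r n.
rewrite dot_tvec !dot_tvec1 /moment !mxE !sum2 !mxE !sum2 !mxE /=.
by ring.
Qed.

(** The Lagrangian condition: every product left in the metric contains an imaginary part of the
    Hermitian form on the real plane. *)
Lemma inner_torus_nor a V W : inner G (pt a) (tv a V) (cj (tv a W)) = 0.
Proof.
rewrite innerE// /kherm (dotC (tv a V)) !dot_cj_tvec.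
by rewrite !(mulr0, mul0r) !subr0 mulr0.
Qed.

(** Each term multiplies a tangent vector by the pairing of the other one with the position, which
    is i times its moment. The two factors i give a sign, and the result is normal. *)
Lemma christoffel_tan a V W :
  christoffel G (pt a) (cj (tv a V)) (cj (tv a W)) =
  tv a (N^-1 *: (mom V *: W + mom W *: V)).
Proof.
rewrite (christoffel_affine epsk eps2 rho0) kform_torus// !dot_cj_tvec !cjK.
rewrite !dotNl !dot_tvec1 !scale0r addr0 sub0r !tvecZ tvecD !tvecZ.
by rewrite !(scaleNr, scalerN) !opprK -opprD scalerN opprK.
Qed.

(** Each term keeps exactly one factor i, so the result is tangent. The parallelism of normal fields
    with constant coefficients rests on this. *)
Lemma christoffel_nor a V W :
  christoffel G (pt a) (cj (tv a V)) (tv a W) =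
  cj (tv a (- N^-1 *: (mom W *: V + mom V *: W))).
Proof.
rewrite (christoffel_affine epsk eps2 rho0) kform_torus// !dot_cj_tvec !cjK.
rewrite !dotNl !dot_tvec1 !scale0r add0r subr0 tvecZ tvecD !tvecZ !cjZ cjD !cjZ.
by rewrite !(scaleNr, scalerN) !opprK.
Qed.

End Torus.
End TorusGeometry.

(** * Second fundamental form and mean curvature of the torus *)

Section PMCTorus.
Variable R : realType.
Implicit Types (V W : 'rV[R]_2).

Lemma inner_addl m (G : 'rV[R]_m -> 'M[R]_m) y u v w :
  inner G y (u + v) w = inner G y u w + inner G y v w.
Proof. by rewrite /inner !mulmxDl mxE. Qed.

(** The contraction sees the coordinate frame [p] and the inverse Gram matrix [I] only through
    [p^T *m I *m p], which will turn out to be constant. *)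
Lemma contract_moment (s : 'I_2 -> R) (I p : 'M[R]_2) (r : R) c :
  \sum_i \sum_j I i j * (r * (moment s (row i p) * p j c + moment s (row j p) * p i c)
                         - p j c * p i c) =
  r * (\sum_b s b ^+ 2 * (p^T *m I *m p) b c + \sum_b s b ^+ 2 * (p^T *m I *m p) c b)
  - (p^T *m I *m p) c c.
Proof.
rewrite /moment !sum2 !mxE !sum2 !mxE !sum2 !mxE.
move: (p 0 0) (p 0 1) (p 1 0) (p 1 1) (p 0 c) (p 1 c) (s 0) (s 1).
move: (I 0 0) (I 0 1) (I 1 0) (I 1 1) => i0 i1 i2 i3 p0 p1 p2 p3 p4 p5 t0 t1.
by ring.
Qed.

Section Torus.
Variables (s : 'I_2 -> R) (eps rho : R) (k : 'I_3).
Hypothesis epsk : eps = 1 \/ k = 0.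
Hypothesis eps2 : eps ^+ 2 = 1.
Hypothesis rho0 : rho != 0.
Hypothesis s0 : forall b, s b != 0.
Local Notation N := (eps + \sum_b s b ^+ 2).
Hypothesis N0 : N != 0.
Local Notation G := (affine_metric eps rho k).
Local Notation tv := (tvec s).
Local Notation pt a := (tv a (const_mx 1)).
Local Notation mom := (moment s).
Local Notation gm := (torus_gram s eps rho).
Local Notation gi := (torus_cogram s eps rho).

Variables (D : set 'rV[R]_2) (al : 'rV[R]_2 -> 'rV[R]_2) (F : 'rV[R]_2 -> 'rV[R]_(2 + 2)).
Hypothesis oD : open D.
Hypothesis Cal : Ck 2 D al.
Hypothesis al_inj : forall x, D x -> forall v, 'D_v al x = 0 -> v = 0.
Hypothesis FE : forall q, D q -> F q = pt (al q).

Lemma derive_torus x w : D x -> 'D_w F x = cj (tv (al x) ('D_w al x)).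
Proof.
move=> Dx; rewrite (open_eq_derive w oD FE Dx).
have dc : differentiable (cst (const_mx 1 : 'rV[R]_2)) x by exact: differentiable_cst.
have [_ ->] := is_derive_tvec s w (Cal.1 x Dx) dc.
rewrite derive_cst -[X in tv _ X + _](scale0r (0 : 'rV_2)) tvecZ scale0r add0r.
by congr (cj (tv _ _)); apply/rowP => b; rewrite !mxE mul1r.
Qed.

Lemma torus_immersion x v : D x -> 'D_v F x = 0 -> v = 0.
Proof.
move=> Dx; rewrite derive_torus// => F0; apply: (al_inj Dx); apply/rowP => b.
(* [cj] preserves [dot], and pairing with the direction of the b-th circle isolates [s b ^+ 2] times
   the b-th angular velocity. *)
have := cj_dot (tv (al x) ('D_v al x)) (tv (al x) (delta_mx 0 b)).
rewrite F0 -(scale0r (0 : 'rV_(2 + 2))) dotZl mul0r dot_tvec (bigD1 b)//=.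
rewrite big1 => [|c cb]; last by rewrite !mxE eqxx (negbTE cb) mulr0 mul0r.
rewrite addr0 !mxE !eqxx mulr1 => /esym/eqP.
by rewrite mulf_eq0 expf_eq0/= (negbTE (s0 b)) orbF => /eqP.
Qed.

(** The Jacobian of the angles, through which the frame and the first form depend on the chart of
    the surface. *)
Let P x : 'M[R]_2 := \matrix_i 'D_(basis_vec R i) al x.

Lemma frame_torus i x : D x -> frame F i x = cj (tv (al x) (row i (P x))).
Proof. by move=> Dx; rewrite /frame derive_torus// rowK. Qed.

Lemma angle_jacobian_unit x : D x -> P x \in unitmx.
Proof.
move=> Dx; rewrite -row_free_unit; apply: inj_row_free => v vP.
apply: (al_inj Dx); rewrite deriveEjacobian; last exact: Cal.1.
rewrite -vP; congr (_ *m _); apply/row_matrixP => i.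
by rewrite rowK deriveEjacobian ?rowE//; exact: Cal.1.
Qed.

Lemma first_form_torus x : D x -> first_form G F x = P x *m gm *m (P x)^T.
Proof.
move=> Dx; apply/matrixP => i j; rewrite mxE !frame_torus// FE// inner_torus//.
by rewrite tr_row -row_mul !mxE; apply: eq_bigr => l _; rewrite !mxE.
Qed.

(** The Jacobian in the first form cancels against the one in the frame, so traces over the
    coordinate frame become traces over the invariant frame. *)
Lemma cofirst_form_torus x : D x ->
  (P x)^T *m invmx (first_form G F x) *m P x = gi.
Proof.
move=> Dx; have uP := angle_jacobian_unit Dx.
have uPT : (P x)^T \in unitmx by rewrite unitmx_tr.
rewrite first_form_torus//.
have -> : invmx (P x *m gm *m (P x)^T) = invmx (P x)^T *m gi *m invmx (P x).
  apply: invmx_uniq; rewrite -!mulmxA (mulmxA (P x)^T) mulmxV// mul1mx.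
  by rewrite (mulmxA gm) torus_gramK// mul1mx mulmxV.
by rewrite !mulmxA mulmxV// mul1mx mulmxKV.
Qed.

Lemma tan_part_torus x V W : D x ->
  tan_part G F x (cj (tv (al x) V) + tv (al x) W) = cj (tv (al x) V).
Proof.
move=> Dx; rewrite /tan_part.
set I := invmx _.
(* The factor before [I] lists the inner products with the frame, and [I] turns them into frame
   coefficients; they recombine to [V] because [gm] and [gi] are inverse. *)
have VE : V = (V *m gm *m (P x)^T) *m I *m P x.
  rewrite -!mulmxA (mulmxA (P x)^T) cofirst_form_torus//.
  by rewrite torus_gramK// mulmx1.
have inE i : inner G (F x) (cj (tv (al x) V) + tv (al x) W) (frame F i x) =
    (V *m gm *m (P x)^T) 0 i.
  rewrite frame_torus// FE// inner_addl inner_torus_nor// addr0 inner_torus//.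
  by rewrite tr_row !mxE; apply: eq_bigr => j _; rewrite !mxE.
rewrite [in RHS]VE mulmx_sum_row tvec_sum.
have cj_sum f : cj (\sum_(i < 2) f i) = \sum_(i < 2) cj (f i).
  by rewrite !sum2 cjD.
rewrite cj_sum exchange_big/=; apply: eq_bigr => j _.
rewrite tvecZ cjZ frame_torus// mxE scaler_suml; apply: eq_bigr => i _.
by rewrite inE mulrC.
Qed.

Lemma nor_part_torus x V W : D x ->
  nor_part G F x (cj (tv (al x) V) + tv (al x) W) = tv (al x) W.
Proof. by move=> Dx; rewrite /nor_part tan_part_torus// addrC addKr. Qed.

(** Second derivatives of the angles give a tangent vector, which the projection removes.
    Differentiating the circles twice gives the term in [pw], and the Christoffel symbol gives the
    two moment terms. *)
Lemma second_form_torus i j x : D x -> second_form G F i j x =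
  tv (al x) (N^-1 *: (mom (row i (P x)) *: row j (P x)
                      + mom (row j (P x)) *: row i (P x))
             - pw (row j (P x)) (row i (P x))).
Proof.
move=> Dx; rewrite /second_form /covD.
have frameE q : D q -> frame F j q = cj (tv (al q) ('D_(basis_vec R j) al q)).
  by move=> Dq; rewrite frame_torus// rowK.
rewrite (open_eq_derive _ oD frameE Dx).
have dP : differentiable ('D_(basis_vec R j) al) x by exact: (Cal.2 _).1.
have [_ ->] := is_derive_cj (is_derive_tvec s (basis_vec R i) (Cal.1 x Dx) dP).
have PE l : 'D_(basis_vec R l) al x = row l (P x) by rewrite rowK.
rewrite derive_torus// frame_torus// FE// !PE christoffel_tan// cjD cjK -addrA.
by rewrite -tvecN -tvecD nor_part_torus// addrC.
Qed.

(** Under the hypotheses of the section it vanishes only if [eps * s c ^+ 2 = 1] for both [c]: for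
    [eps = 1] this is the minimal Clifford torus, and for [eps = -1] it is impossible. *)
Definition torus_curvature : 'rV[R]_2 :=
  \row_c (2^-1 * (rho * N * (eps - (s c ^+ 2)^-1))).

Lemma mean_curvature_torus x : D x ->
  mean_curvature G F x = tv (al x) torus_curvature.
Proof.
move=> Dx; rewrite /mean_curvature.
under eq_bigr => i _ do under eq_bigr => j _ do
  rewrite second_form_torus// -tvecZ.
under eq_bigr do rewrite -tvec_sum.
rewrite -tvec_sum -tvecZ; congr tv; apply/rowP => c.
have QE := cofirst_form_torus Dx.
set I := invmx _ in QE *.
rewrite mxE summxE; under eq_bigr do rewrite summxE.
(* Each weighted sum of [gi] equals [rho * eps * N ^+ 2], since
   [1 + eps * \sum_b s b ^+ 2 = eps * N]. *)
transitivity (2^-1 * (N^-1 * (\sum_b s b ^+ 2 * gi b c + \sum_b s b ^+ 2 * gi c b) - gi c c)).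
  rewrite -QE -contract_moment; congr (_ * _).
  by apply: eq_bigr => i _; apply: eq_bigr => j _; rewrite !mxE.
rewrite /torus_curvature [RHS]mxE; congr (_ * _); move: c.
have [e|e] : eps = 1 \/ eps = -1.
  by move/eqP : eps2; rewrite sqrf_eq1 => /orP[] /eqP ->; [left|right].
all: apply: ord2_ind; rewrite !sum2 !mxE sum2/=.
all: move: N0 (s0 0) (s0 1); rewrite sum2 e => n0 x0 y0.
all: by field; rewrite n0 x0 ?y0.
Qed.

Lemma torus_pmc x : (exists b, eps * s b ^+ 2 != 1) -> D x ->
  mean_curvature G F x <> 0 /\
  forall w, normal_conn G F (mean_curvature G F) w x = 0.
Proof.
move=> [b sb] Dx; split=> [|w].
  rewrite mean_curvature_torus// => H0.
  have := dot_tvec s (al x) torus_curvature (delta_mx 0 b).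
  rewrite H0 -(scale0r (0 : 'rV_(2 + 2))) dotZl mul0r (bigD1 b)//= big1 => [|c cb].
    rewrite addr0 !mxE !eqxx mulr1 => /esym/eqP.
    rewrite !mulf_eq0 invr_eq0 (negbTE rho0) (negbTE N0) pnatr_eq0/=.
    rewrite (negbTE (s0 b)) ?orbF subr_eq0 => /eqP E.
    by move: sb; rewrite E mulVf ?eqxx// expf_neq0.
  by rewrite !mxE eqxx (negbTE cb) mulr0 mul0r.
rewrite /normal_conn /covD (open_eq_derive _ oD mean_curvature_torus Dx).
have dc : differentiable (cst torus_curvature : 'rV[R]_2 -> 'rV[R]_2) x.
  exact: differentiable_cst.
have [_ ->] := is_derive_tvec s w (Cal.1 x Dx) dc.
rewrite derive_cst -[X in tv _ X + _](scale0r (0 : 'rV_2)) tvecZ scale0r add0r.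
rewrite derive_torus// mean_curvature_torus// FE// christoffel_nor// -cjD -tvecD.
have tv0 : tv (al x) 0 = 0 by rewrite -(scale0r (0 : 'rV_2)) tvecZ scale0r.
(* The covariant derivative is a pure [cj] term; adding the normal vector 0 gives it the shape whose
   normal part is known. *)
by rewrite -[cj _]addr0 -[X in _ + X]tv0 nor_part_torus.
Qed.

End Torus.
End PMCTorus.

(** * Smoothness, relative angles and transition maps *)

Section SmoothTorus.
Variable R : realType.

Lemma Ck_subset (V W : normedModType R) k (D E : set V) (f : V -> W) :
  E `<=` D -> Ck k D f -> Ck k E f.
Proof.
move=> ED; elim: k f => [|k IHk] f; first by move=> Cf x /ED; exact: Cf.
by move=> [df Cf]; split=> [x /ED|v]; [exact: df|exact/IHk/Cf].
Qed.

Lemma Ck_rV (V : normedModType R) n k (D : set V) (f : V -> 'rV[R]_n) : open D ->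
  (forall j, Ck k D (fun q => f q 0 j)) -> Ck k D f.
Proof.
move=> oD Cf.
have -> : f = \sum_j (fun q => f q 0 j *: delta_mx 0 j).
  by apply/funext => q; rewrite fct_sumE -row_sum_delta.
elim/big_ind : _ => [|g h|j _]; first exact: Ck_cst.
  exact: CkD.
exact: CkZl.
Qed.

Lemma Ck_tvec (V : normedModType R) k (D : set V) s (al : V -> 'rV[R]_2) :
  open D -> Ck k D al -> Ck k D (fun q => tvec s (al q) (const_mx 1)).
Proof.
move=> oD Cal; apply: Ck_rV => // j.
case: (split_ordP j) => b ->.
  rewrite (_ : (fun q => _) = cst (s b) * (cos \o (fun q => al q 0 b))).
    by apply: CkM => //; [exact: Ck_cst|exact: (Ck_trig oD (Ck_coord oD _ Cal)).1].
  by apply/funext => q; rewrite tvec_lshift mxE mul1r.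
rewrite (_ : (fun q => _) = cst (s b) * (sin \o (fun q => al q 0 b))).
  by apply: CkM => //; [exact: Ck_cst|exact: (Ck_trig oD (Ck_coord oD _ Cal)).2].
by apply/funext => q; rewrite tvec_rshift mxE mul1r.
Qed.

Section Angles.
Implicit Types (w : 'rV[R]_2).

(* Arguments of the homogeneous coordinates of [1 : e^(i w_0) : e^(i w_1)]. *)
Definition angle w (j : 'I_3) : R := oapp (fun b => w 0 b) 0 (unlift ord0 j).

(** Dividing homogeneous coordinates by the k-th one subtracts its argument from the others. *)
Definition rel_angle (k : 'I_3) w : 'rV[R]_2 :=
  \row_b (angle w (lift k b) - angle w k).

(** All three arguments agree, and the one with index 0 is normalised to 0. *)
Lemma rel_angle_inj k w : rel_angle k w = 0 -> w = 0.
Proof.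
move=> w0.
have wk j : angle w j = angle w k.
  case: (unliftP k j) => [b ->|->//].
  by move/rowP : w0 => /(_ b); rewrite !mxE => /eqP; rewrite subr_eq0 => /eqP.
apply/rowP => b; rewrite mxE; transitivity (angle w (lift ord0 b)).
  by rewrite /angle liftK.
by rewrite wk -(wk ord0) /angle unlift_none.
Qed.

Lemma derive_rel_angle (V : normedModType R) k (psi : V -> 'rV[R]_2) (w0 : 'rV[R]_2) x v :
  differentiable psi x ->
  'D_v (fun y => rel_angle k (psi y - w0)) x = rel_angle k ('D_v psi x).
Proof.
move=> dpsi.
have Dang j : is_derive x v (fun y => angle (psi y - w0) j) (angle ('D_v psi x) j).
  rewrite /angle; case: unlift => [b|] /=; last exact: is_derive_cst.
  have Dp : is_derive x v (fun y => psi y 0 b) (('D_v psi x) 0 b).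
    apply: DeriveDef; last by rewrite derive_coord.
    by apply: ((derivable_mxP psi x v).1 _ 0 b); exact: diff_derivable.
  rewrite (_ : (fun y => _) = (fun y => psi y 0 b) - cst (w0 0 b)).
    by apply: is_derive_eq; rewrite subr0.
  by apply/funext => y; rewrite !mxE.
suff [] : is_derive x v (fun y => rel_angle k (psi y - w0)) (rel_angle k ('D_v psi x)) by [].
apply: is_derive_rV => b; rewrite mxE.
rewrite (_ : (fun y => _) = (fun y => angle (psi y - w0) (lift k b))
                            - (fun y => angle (psi y - w0) k)).
  exact: is_deriveB.
by apply/funext => y; rewrite !mxE.
Qed.

Lemma Ck_rel_angle (V : normedModType R) n (D : set V) k (psi : V -> 'rV[R]_2) (w0 : 'rV[R]_2) :
  open D -> Ck n D psi -> Ck n D (fun y => rel_angle k (psi y - w0)).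
Proof.
move=> oD Cpsi.
have Cang j : Ck n D (fun y => angle (psi y - w0) j).
  rewrite /angle; case: unlift => [b|] /=; last exact: Ck_cst.
  rewrite (_ : (fun y => _) = (fun y => psi y 0 b) + cst (- w0 0 b)).
    by apply: CkD => //; [exact: Ck_coord|exact: Ck_cst].
  by apply/funext => y; rewrite !mxE.
apply: Ck_rV => // b.
rewrite (_ : (fun y => _) = (fun y => angle (psi y - w0) (lift k b))
                            + cst (-1) * (fun y => angle (psi y - w0) k)).
  by apply: CkD => //; apply: CkM => //; exact: Ck_cst.
by apply/funext => y; rewrite !mxE !fctE mulN1r.
Qed.

End Angles.

Section Transition.
Variables (n : nat) (M : topologicalType) (A : atlas R n M).
Hypothesis hM : smooth_manifold A.

Lemma cinvK (c : chart A) x0 x : dom c x -> cinv c x0 (coord c x) = x.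
Proof.
move=> cx; rewrite /cinv; case: xgetP => [y _ [cy yx]|/(_ x)[]//].
by have [_ _ /(_ c)[_ + _] _] := hM; apply => //; rewrite inE.
Qed.

Lemma open_coord (c : chart A) (V : set M) : open V -> V `<=` dom c -> open (coord c @` V).
Proof. by move=> oV Vc; have [_ _ /(_ c)[_ _ /(_ V Vc)[+ _]] _] := hM; apply. Qed.

Lemma open_dom (c : chart A) : open (dom c).
Proof. by have [_ _ /(_ c)[]] := hM. Qed.

Lemma coord_inj (c : chart A) x y : dom c x -> dom c y -> coord c x = coord c y -> x = y.
Proof. by move=> cx cy; have [_ _ /(_ c)[_ + _] _] := hM; apply; rewrite inE. Qed.

(** Continuity of a chart, recovered from the condition that a subset of its domain is open exactly
    when its image is. *)
Lemma open_coord_preimage (c : chart A) (O : set 'rV[R]_n) :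
  open O -> open (dom c `&` coord c @^-1` O).
Proof.
move=> oO; have [_ _ /(_ c)[oc inj oE] _] := hM.
apply/oE => [x []//|].
rewrite (_ : coord c @` _ = coord c @` dom c `&` O).
  by apply: openI => //; apply/oE.
apply/seteqP; split=> [_ [x [cx Ox] <-]|_ [[x cx <-] Ox]].
  by split=> //; exists x.
by exists x.
Qed.

(** The opposite transition map is a differentiable left inverse near the point, so the chain rule
    makes the differential injective. *)
Lemma transition_immersion (c d : chart A) x0 x v : dom c x -> dom d x ->
  'D_v (fun y => coord d (cinv c x0 y)) (coord c x) = 0 -> v = 0.
Proof.
move=> cx dx D0.
have [_ _ _ sm] := hM.
pose psi y := coord d (cinv c x0 y); pose chi y := coord c (cinv d x0 y).
pose E := coord c @` (dom c `&` dom d).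
have oE : open E by apply: open_coord => [|y []//]; apply: openI; exact: open_dom.
have Ex : E (coord c x) by exists x.
have dpsi : differentiable psi (coord c x) by exact: (sm c d x0 1%N).1.
have psix : psi (coord c x) = coord d x by rewrite /psi cinvK.
have dchi : differentiable chi (psi (coord c x)).
  by apply: (sm d c x0 1%N).1; exists x.
have psiK y : E y -> (chi \o psi) y = id y.
  by move=> [z [cz dz] <-]; rewrite /= /chi /psi !cinvK.
have D : 'D_v (chi \o psi) (coord c x) = v.
  by rewrite (open_eq_derive v oE psiK Ex) derive_id.
have d0 : 'd psi (coord c x) v = 0 by rewrite -(deriveE v dpsi); exact: D0.
have dE : 'D_v (chi \o psi) (coord c x) = ('d chi (psi (coord c x)) \o 'd psi (coord c x)) v.
  rewrite -(diff_comp dpsi dchi); apply: deriveE.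
  exact: differentiable_comp.
apply: etrans (esym D) (etrans dE _).
exact: etrans (congr1 ('d chi (psi (coord c x))) d0) (linear0 _).
Qed.

End Transition.
End SmoothTorus.

(** * The torus map seen in arbitrary charts *)

Section LocalTorus.
Variables (R : realType) (M : topologicalType) (A : atlas R 2 M).
Hypothesis hM : smooth_manifold A.
Variables (c0 : chart A) (w0 : 'rV[R]_2) (U : set M).
Hypotheses (oU : open U) (Uc0 : U `<=` dom c0).
Variables (N : topologicalType) (B : atlas R (2 + 2) N) (f : M -> N) (d : chart B).
Variables (k : 'I_3) (s : 'I_2 -> R).
Hypothesis s0 : forall b, s b != 0.
Hypothesis fE : forall x,
  coord d (f x) = tvec s (rel_angle k (coord c0 x - w0)) (const_mx 1).

Let psi (c : chart A) x0 y := coord c0 (cinv c x0 y).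
Let al (c : chart A) x0 y := rel_angle k (psi c x0 y - w0).
(** The preimage of [dom d] is left out: [fE] holds at every point, and this larger set is open
    without appeal to the continuity of [f]. *)
Let D (c : chart A) := coord c @` (U `&` dom c).

Let oD c : open (D c).
Proof. by apply: (open_coord hM) => [|x []//]; apply: openI => //; exact: open_dom. Qed.

Let Cpsi c x0 n : Ck n (D c) (psi c x0).
Proof.
have [_ _ _ /(_ c c0 x0 n)] := hM; apply: Ck_subset.
by move=> _ [x [/Uc0 Ux cx] <-]; exists x.
Qed.

Let Cal c x0 n : Ck n (D c) (al c x0).
Proof. exact: Ck_rel_angle. Qed.

Let al_inj c x0 y : D c y -> forall v, 'D_v (al c x0) y = 0 -> v = 0.
Proof.
move=> Dy v; rewrite derive_rel_angle; last exact: (Cpsi c x0 1).1.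
move=> /rel_angle_inj; case: Dy => x [Ux cx] <-.
by apply: (transition_immersion hM) => //; exact: Uc0.
Qed.

Let FE c x0 y : D c y ->
  local_expr f c d x0 y = tvec s (al c x0 y) (const_mx 1).
Proof. by move=> _; rewrite /local_expr fE. Qed.

Lemma local_torus_smooth c x0 :
  smooth_on (coord c @` (U `&` dom c `&` f @^-1` dom d)) (@local_expr R 2 (2 + 2) M N A B f c d x0).
Proof.
move=> n; apply: (@Ck_subset _ _ _ _ (D c)).
  by move=> _ [x [Ucx _] <-]; exists x.
have Ct : Ck n (D c) (fun y => tvec s (al c x0 y) (const_mx 1)).
  exact: Ck_tvec.
by apply: (eq_Ck (@oD c) _ Ct) => y Dy; rewrite FE.
Qed.

Lemma local_torus_immersion c x v : U x -> dom c x ->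
  'D_v (@local_expr R 2 (2 + 2) M N A B f c d x) (coord c x) = 0 -> v = 0.
Proof.
move=> Ux cx; apply: (torus_immersion s0 (@oD c) (Cal c x 2) (@al_inj c x) (@FE c x)).
by exists x.
Qed.

Lemma local_torus_pmc eps rho c x : eps = 1 \/ k = 0 -> eps ^+ 2 = 1 -> rho != 0 ->
  eps + \sum_b s b ^+ 2 != 0 -> (exists b, eps * s b ^+ 2 != 1) ->
  U x -> dom c x ->
  let G := affine_metric eps rho k in
  let H := mean_curvature G (@local_expr R 2 (2 + 2) M N A B f c d x) in
  H (coord c x) <> 0 /\
  forall w, normal_conn G (@local_expr R 2 (2 + 2) M N A B f c d x) H w (coord c x) = 0.
Proof.
move=> epsk eps2 rho0 N0 sb Ux cx.
apply: (torus_pmc epsk eps2 rho0 s0 N0 (@oD c) (Cal c x 2) (@al_inj c x) (@FE c x) sb).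
by exists x.
Qed.

End LocalTorus.

(** * Continuity of complex-valued maps *)

Section ComplexTopology.
Variable R : realType.
Local Notation C := (Cplx R).

Lemma normC_le (a b : R) : `|Complex a b : C| <= (`|a| + `|b|)%:C%C.
Proof.
rewrite normc_def lecR -[leRHS]ger0_norm ?addr_ge0// -sqrtr_sqr.
apply: ler_wsqrtr; rewrite sqrrD /= !real_normK ?num_real// lerD2r lerDl.
by rewrite mulrn_wge0// mulr_ge0.
Qed.

Lemma Im_le_norm (z : C) : (`|complex.Im z|)%:C%C <= `|z|.
Proof.
by rewrite normc_def lecR -sqrtr_sqr ler_wsqrtr// lerDr sqr_ge0.
Qed.

Lemma rV_continuous (T : topologicalType) (K : numFieldType) n (f : T -> 'rV[K]_n) x :
  (forall j, {for x, continuous (fun t => f t 0 j)}) -> {for x, continuous f}.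
Proof.
move=> cf B /nbhs_ballP[e e0 eB]; apply: filterS (eB) _.
suff : \forall t \near x, forall j, ball (f x 0 j) e (f t 0 j).
  by apply: filterS => t Ht; split=> // i j; rewrite ord1.
by apply: filter_forall => j; apply: cf; exact: nbhsx_ballx.
Qed.

Lemma Complex_continuous (T : topologicalType) (f g : T -> R) x :
  {for x, continuous f} -> {for x, continuous g} ->
  {for x, continuous (fun t => Complex (f t) (g t) : C)}.
Proof.
move=> cf cg B /nbhs_ballP[e /= e0 eB]; apply: filterS (eB) _.
(* The radius of a ball in [C] is itself a complex number; the order forces a positive one to be
   real. *)
move: e0; rewrite ltcE /= => /andP[/eqP Ie Re0].
have eE : e = (complex.Re e)%:C%C by case: e Ie {eB Re0} => ? ? /= ->.
have e20 : 0 < complex.Re e / 2 by rewrite divr_gt0.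
have nf : \forall t \near x, `|f x - f t| < complex.Re e / 2.
  by apply: (cf (ball (f x) (complex.Re e / 2))); exact: nbhsx_ballx.
have ng : \forall t \near x, `|g x - g t| < complex.Re e / 2.
  by apply: (cg (ball (g x) (complex.Re e / 2))); exact: nbhsx_ballx.
suff : \forall t \near x,
    ball (Complex (f x) (g x) : C) e (Complex (f t) (g t) : C) by [].
near=> t.
have ft : `|f x - f t| < complex.Re e / 2 by near: t.
have gt : `|g x - g t| < complex.Re e / 2 by near: t.
rewrite -ball_normE /= eE.
have -> : (Complex (f x) (g x) : C) - Complex (f t) (g t) = Complex (f x - f t) (g x - g t).
  by [].
apply: le_lt_trans (normC_le _ _) _.
by rewrite ltcR (splitr (complex.Re e)) ltrD.
Unshelve. all: by end_near. Qed.

Lemma Im_continuous : continuous (fun z : C => complex.Im z).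
Proof.
move=> z B /nbhs_ballP[e /= e0 eB].
have e0C : 0 < e%:C%C :> C by rewrite ltcR.
apply: filterS (nbhsx_ballx z _ e0C) => y; rewrite -ball_normE /= => zy.
apply: eB; rewrite -ball_normE /= -ltcR; apply: le_lt_trans zy.
by rewrite -raddfB; exact: Im_le_norm.
Qed.

End ComplexTopology.

(** * Representatives of points of the projective plane *)

Section ProjectivePlane.
Variable R : realType.
Local Notation C := (Cplx R).

Lemma val_proj (z : 'rV[C]_3) : z != 0 -> val (proj z) = <[z]>%VS.
Proof. by move=> z0; rewrite /proj insubdK// unfold_in dim_vline z0. Qed.

(** [vpick] returns an unspecified generator of the line; chart domains and coordinates are
    invariant under scaling, so the unknown factor [l] drops out of both. *)
Lemma hom_coord_proj (z : 'rV[C]_3) : z != 0 ->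
  exists2 l : C, l != 0 & hom_coord (proj z) = l *: z.
Proof.
move=> z0; rewrite /hom_coord val_proj//.
have /vlineP[l lE] := memv_pick <[z]>%VS.
exists l => //; apply: contraNneq z0 => l0.
have : <[z]>%VS == 0%VS by rewrite -vpick0 lE l0 scale0r.
by move/eqP => z0'; have := dim_vline z; rewrite z0' dimv0; case: eqP.
Qed.

Lemma CP2_dom_proj k (z : 'rV[C]_3) : z != 0 -> CP2_dom k (proj z) <-> z 0 k != 0.
Proof.
move=> /hom_coord_proj[l l0 lE]; rewrite /CP2_dom /= lE mxE mulf_eq0 (negbTE l0).
by [].
Qed.

Lemma CP2_coord_proj k (z : 'rV[C]_3) : z != 0 ->
  CP2_coord k (proj z) = real_coord (col' k ((z 0 k)^-1 *: z)).
Proof.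
move=> /hom_coord_proj[l l0 lE]; rewrite /CP2_coord lE mxE scalerA.
by rewrite invfM mulrAC mulVf// mul1r.
Qed.

End ProjectivePlane.

(** * The torus in homogeneous coordinates *)

Section TorusPoint.
Variable R : realType.
Local Notation C := (Cplx R).
Implicit Types (r : 'I_3 -> R) (w : 'rV[R]_2).

Definition torus_lift r w : 'rV[C]_3 :=
  \row_j Complex (r j * cos (angle w j)) (r j * sin (angle w j)).

Definition ratio r (k : 'I_3) (b : 'I_2) : R := r (lift k b) / r k.

Lemma polar_neq0 (x t : R) : x != 0 -> (Complex (x * cos t) (x * sin t) : C) != 0.
Proof.
move=> x0; rewrite eq_complex /= !mulf_eq0 (negbTE x0) /=; apply/negP.
move=> /andP[/eqP c0 /eqP s0]; have := cos2Dsin2 t.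
by rewrite c0 s0 expr0n addr0 => /esym/eqP; rewrite oner_eq0.
Qed.

Lemma polar_div (x y t u : R) : y != 0 ->
  (Complex (y * cos u) (y * sin u) : C)^-1 * Complex (x * cos t) (x * sin t) =
  Complex (x / y * cos (t - u)) (x / y * sin (t - u)).
Proof.
move=> y0; have D0 := polar_neq0 u y0.
apply: (mulfI D0); rewrite mulVKf// mul_Complex cosB sinB.
have e : cos u ^+ 2 + sin u ^+ 2 = 1 by exact: cos2Dsin2.
congr Complex; [rewrite -[LHS]mulr1|rewrite -[LHS]mulr1]; rewrite -e.
  by field.
by field.
Qed.

Section Lift.
Variable r : 'I_3 -> R.
Hypothesis r0 : forall j, r j != 0.

Lemma torus_lift_neq0 w : torus_lift r w != 0.
Proof.
apply/eqP => /rowP/(_ 0)/eqP; rewrite !mxE; exact/negP/polar_neq0.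
Qed.

Lemma CP2_dom_torus k w : CP2_dom k (proj (torus_lift r w)).
Proof.
by apply/CP2_dom_proj; [exact: torus_lift_neq0|rewrite mxE polar_neq0].
Qed.

Lemma CP2_coord_torus k w :
  CP2_coord k (proj (torus_lift r w)) =
  tvec (ratio r k) (rel_angle k w) (const_mx 1).
Proof.
rewrite CP2_coord_proj ?torus_lift_neq0// /real_coord /tvec.
by congr row_mx; apply/rowP => b; rewrite !mxE polar_div// mul1r.
Qed.

(** The factor [l] is there because negativity of a line is tested on all of its nonzero vectors. *)
Lemma hform_torus_lift (l : C) w :
  hform (-1) (l *: torus_lift r w) (l *: torus_lift r w) =
  `|l| ^+ 2 * (- r 0 ^+ 2 + (r (lift 0 0) ^+ 2 + r (lift 0 1) ^+ 2))%:C%C.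
Proof.
have polar2 (x t : R) : (Complex (x * cos t) (x * sin t) : C)
   * (Complex (x * cos t) (x * sin t))^* = (x ^+ 2)%:C%C.
  rewrite conj_Complex mul_Complex; congr Complex; last by ring.
  by rewrite -[RHS]mulr1 -(cos2Dsin2 t); ring.
have E (x t : R) : l * Complex (x * cos t) (x * sin t)
   * (l * Complex (x * cos t) (x * sin t))^* = `|l| ^+ 2 * (x ^+ 2)%:C%C.
  by rewrite rmorphM mulrACA polar2 normCK.
have -> : lift 0 1 = lift ord0 (lift ord0 ord0) :> 'I_3 by exact: val_inj.
move: (`|l| ^+ 2) E => L E.
rewrite /hform !big_ord_recl big_ord0 !mxE /= !mul1r.
have -> : Complex (-1) 0 = -1 :> C by rewrite -[RHS]/(Complex _ _) oppr0.
rewrite mulN1r !mulNr !E addr0 -mulrDr -mulrN -mulrDr; congr (_ * _).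
by rewrite !rmorphD rmorphN.
Qed.

Lemma torus_lift_continuous : continuous (torus_lift r).
Proof.
move=> w; apply: rV_continuous => j.
have ca : {for w, continuous (fun v => angle v j)}.
  rewrite /angle; case: unlift => [b|] /=; last exact: cst_continuous.
  exact: coord_continuous.
rewrite (_ : (fun t => _) = (fun t =>
    Complex (r j * cos (angle t j)) (r j * sin (angle t j)) : C)); last first.
  by apply/funext => t; rewrite mxE.
apply: Complex_continuous.
  apply: (@continuousM _ _ (cst (r j)) (fun t => cos (angle t j))); first exact: cst_continuous.
  exact: continuous_comp ca (@continuous_cos _ _).
apply: (@continuousM _ _ (cst (r j)) (fun t => sin (angle t j))); first exact: cst_continuous.
exact: continuous_comp ca (@continuous_sin _ _).
Qed.

End Lift.
End TorusPoint.

(** * The topological embedding of a patch *)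

Section Embedding.
Variables (R : realType) (M : topologicalType) (A : atlas R 2 M).
Hypothesis hM : smooth_manifold A.
Local Notation C := (Cplx R).

Lemma asin_sin (t : R) : `|t| < 1 -> `|sin t| < 1 /\ asin (sin t) = t.
Proof.
rewrite ltr_norml => /andP[t1 t2].
have p1 : 1 <= pi / 2 :> R by exact: pihalf_ge1.
have tp : - (pi / 2) < t < pi / 2 by apply/andP; split; lra.
split; last by apply: sinK; rewrite in_itv/=; apply/andP; split; lra.
have c0 : 0 < cos t by exact: cos_gt0_pihalf.
have := cos2Dsin2 t; have : 0 < cos t ^+ 2 by rewrite exprn_gt0.
move=> c1 c2; rewrite -(@ltr_pXn2r _ 2)// ?nnegrE// expr1n real_normK ?num_real//; lra.
Qed.

Variables (c0 : chart A) (w0 : 'rV[R]_2) (r : 'I_3 -> R).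
Hypothesis r0 : forall j, r j != 0.

(** Radius 1 is at most pi / 2, so on this patch [asin] recovers each angle from its sine. *)
Definition torus_patch : set M := dom c0 `&` coord c0 @^-1` ball w0 1.

Definition torus_map (x : M) : CP2 R := proj (torus_lift r (coord c0 x - w0)).

Local Notation U := torus_patch.
Local Notation f := torus_map.

Lemma open_torus_patch : open U.
Proof. by apply: (open_coord_preimage hM); exact: ball_open. Qed.

(* Recovers the sine of the b-th angle of a point of the torus. *)
Definition sine (b : 'I_2) (L : CP2 R) : R :=
  CP2_coord ord0 L 0 (rshift 2 b) / ratio r ord0 b.

Lemma sine_torus b w : sine b (proj (torus_lift r w)) = sin (w 0 b).
Proof.
rewrite /sine CP2_coord_torus// tvec_rshift !mxE mul1r mulrAC mulfV.
  by rewrite mul1r /angle liftK unlift_none subr0.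
by rewrite mulf_neq0// invr_eq0.
Qed.

Lemma sine_patch b x : U x ->
  `|sine b (f x)| < 1 /\ asin (sine b (f x)) + w0 0 b = coord c0 x 0 b.
Proof.
move=> [_ [_ /(_ 0 b)]]; rewrite -ball_normE/= distrC => xb.
have -> : sine b (f x) = sin (coord c0 x 0 b - w0 0 b) by rewrite sine_torus !mxE.
by have [s1 ->] := asin_sin xb; rewrite subrK.
Qed.

Lemma torus_map_inj : {in U &, injective f}.
Proof.
move=> x y; rewrite !inE => Ux Uy fxy; apply: (coord_inj hM Ux.1 Uy.1).
by apply/rowP => b; rewrite -(sine_patch b Ux).2 -(sine_patch b Uy).2 fxy.
Qed.

Lemma torus_map_continuous x : U x -> {for x, continuous f}.
Proof.
move=> [cx _] V /=; rewrite nbhsE => -[W [oW Wfx] WV].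
pose O := [set w : 'rV[R]_2 | W (proj (torus_lift r (w - w0)))].
have oO : open O.
  pose g (w : 'rV[R]_2) : 'rV[R]_2 := w - w0.
  have cg : continuous g.
    by move=> w; apply: continuousB; [exact: cvg_id|exact: cst_continuous].
  have cl : continuous (torus_lift r \o g).
    by move=> w; apply: continuous_comp; [exact: cg|exact: torus_lift_continuous].
  have oW' : open [set z : 'rV[C]_3 | z != 0 /\ W (proj z)] by exact: oW.
  have := (continuousP _).1 cl _ oW'.
  rewrite (_ : _ @^-1` _ = O)//; apply/seteqP; split=> w /=; first by case.
  by split=> //; exact: torus_lift_neq0.
apply: (@filterS _ _ _ (dom c0 `&` coord c0 @^-1` O)) => [y [_ Oy]|]; first exact: WV.
by apply: open_nbhs_nbhs; split=> //; exact: (open_coord_preimage hM).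
Qed.

(** Openness onto the image comes from a continuous left inverse that is defined on an open set of
    lines: sines in chart 0, then [asin], then a shift by [w0]. *)
Lemma torus_map_open V : V `<=` U -> open V ->
  exists2 W : set (CP2 R), open W & f @` V = W `&` f @` U.
Proof.
move=> VU oV.
pose O := coord c0 @` V.
have oO : open O by apply: (open_coord hM) => // x /VU[].
pose h (y : 'rV[R]_2) : 'rV[R]_2 := \row_b (asin (y 0 b) + w0 0 b).
(* The bound keeps each entry in the open interval where [asin] is continuous, so that [Y] is
   open. *)
pose Y := [set y : 'rV[R]_2 | (forall b, `|y 0 b| < 1) /\ O (h y)].
exists [set L | CP2_dom ord0 L /\ Y (\row_b sine b L)].
  (* the definition of the quotient topology, unfolded *)
  suff oz : open [set z : 'rV[C]_3 | z != 0 /\ (CP2_dom ord0 (proj z) /\ Y (\row_b sine b (proj z)))].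
    exact: oz.
  (* [q] is [sine] written with the vector [z] itself in place of the representative picked from its
     line; in this form continuity is visible. *)
  pose q (b : 'I_2) (z : 'rV[C]_3) : R := complex.Im ((z 0 ord0)^-1 * z 0 (lift ord0 b)) / ratio r ord0 b.
  have -> : [set z : 'rV[C]_3 | z != 0 /\ (CP2_dom ord0 (proj z) /\ Y (\row_b sine b (proj z)))] =
     [set z : 'rV[C]_3 | z 0 ord0 != 0 /\ Y (\row_b q b z)].
    have qE (z : 'rV[C]_3) : z != 0 -> \row_b sine b (proj z) = \row_b q b z.
      by move=> z0; apply/rowP => b; rewrite !mxE /sine CP2_coord_proj// row_mxEr !mxE.
    apply/seteqP; split=> z /=.
      by move=> [z0 [dz Yz]]; split; [exact/CP2_dom_proj|rewrite -qE].
    move=> [z00 Yz]; have z0 : z != 0 by apply: contraNneq z00 => ->; rewrite mxE.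
    by split=> //; split; [exact/CP2_dom_proj|rewrite qE].
  have oY : open Y.
    rewrite openE => y [y1 Oy].
    have ch : {for y, continuous h}.
      apply: rV_continuous => b.
      rewrite (_ : (fun t => _) = (fun t : 'rV[R]_2 => asin (t 0 b)) + cst (w0 0 b)); last first.
        by apply/funext => t; rewrite mxE.
      apply: continuousD; last exact: cst_continuous.
      apply: (@continuous_comp _ _ _ (fun t : 'rV[R]_2 => t 0 b)).
        exact: coord_continuous.
      by apply: continuous_asin; rewrite -ltr_norml.
    have n1 : \forall t \near y, forall b, `|(t : 'rV[R]_2) 0 b| < 1.
      suff nb b : \forall t \near y, `|(t : 'rV[R]_2) 0 b| < 1.
        have H := @filter_forall _ _ (fun b (t : 'rV[R]_2) => `|t 0 b| < 1) (nbhs y) _ nb.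
        exact: H.
      have cb : {for y, continuous (fun t : 'rV[R]_2 => t 0 b)} by exact: coord_continuous.
      have ob : open [set t : R | `|t| < 1].
        rewrite (_ : mkset _ = ball 0 1); first exact: ball_open.
        by apply/seteqP; split=> t; rewrite -ball_normE /= sub0r normrN.
      have nb1 : nbhs (y 0 b) [set t : R | `|t| < 1].
        by apply: open_nbhs_nbhs; split=> //; exact: y1.
      exact: cb nb1.
    have nO : \forall t \near y, O (h t).
      have nbO : nbhs (h y) O by apply: open_nbhs_nbhs; split.
      exact: ch nbO.
    by apply: filterS2 n1 nO => t; split.
  rewrite openE => z /= [z0 Yz].
  have cz j : {for z, continuous (fun t : 'rV[C]_3 => t 0 j)} by exact: coord_continuous.
  have n0 : \forall t \near z, (t : 'rV[C]_3) 0 ord0 != 0.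
    suff nb0 : nbhs (z 0 ord0) [set t : C | t != 0] by exact: cz nb0.
    apply: open_nbhs_nbhs; split=> //.
    rewrite (_ : mkset _ = ~` [set 0]).
      by apply: closed_openC; apply: accessible_closed_set1;
        apply: hausdorff_accessible; exact: norm_hausdorff.
    by apply/seteqP; split=> t /= /eqP.
  have cq : {for z, continuous (fun t => \row_b q b t)}.
    apply: rV_continuous => b.
    rewrite (_ : (fun t => _) = q b); last by apply/funext => t; rewrite mxE.
    apply: (@continuousM _ _ (fun t : 'rV[C]_3 =>
        complex.Im ((t 0 ord0)^-1 * t 0 (lift ord0 b))) (cst (ratio r ord0 b)^-1)).
      apply: (@continuous_comp _ _ _ (fun t : 'rV[C]_3 => (t 0 ord0)^-1 * t 0 (lift ord0 b))).
        apply: (@continuousM _ _ (fun t : 'rV[C]_3 => (t 0 ord0)^-1)); last exact: cz.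
        by apply: continuousV => //; exact: cz.
      exact: Im_continuous.
    exact: cst_continuous.
  have nY : \forall t \near z, Y (\row_b q b t).
    have nbY : nbhs (\row_b q b z) Y by apply: open_nbhs_nbhs; split.
    exact: cq nbY.
  by apply: filterS2 n0 nY => t; split.
apply/seteqP; split=> [_ [x Vx <-]|L [[_ [_ Oh]] [x Ux xL]]].
  have Ux := VU _ Vx.
  split; last by exists x.
  split; first exact: CP2_dom_torus.
  split=> [b|]; first by rewrite mxE (sine_patch b Ux).1.
  exists x => //; apply/rowP => b; rewrite !mxE.
  by rewrite (sine_patch b Ux).2.
exists x => //; move: Oh.
rewrite -xL => -[y Vy yh].
suff -> : x = y by [].
apply: (coord_inj hM Ux.1 (VU _ Vy).1); rewrite yh.
by apply/rowP => b; rewrite !mxE (sine_patch b Ux).2.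
Qed.

End Embedding.

(** * Choice of radii in the two planes *)

Section TorusEmbeddings.
Variables (R : realType) (M : topologicalType) (A : atlas R 2 M).
Hypothesis hM : smooth_manifold A.
Variables (c0 : chart A) (w0 : 'rV[R]_2).
Local Notation U := (torus_patch c0 w0).

Lemma ratio_neq0 (r : 'I_3 -> R) k b : (forall j, r j != 0) -> ratio r k b != 0.
Proof. by move=> r0; rewrite mulf_neq0// invr_eq0. Qed.

Lemma torus_patch_dom : U `<=` dom c0.
Proof. by move=> x []. Qed.

Lemma CP2_torus_pmc (rho : R) : 0 < rho ->
  pmc_embedding A (CP2_atlas R) (CP2_metric rho) U
    (torus_map c0 w0 (fun j : 'I_3 => j.+1%:R)).
Proof.
move=> rho0; set r := fun j : 'I_3 => j.+1%:R : R.
have r0 j : r j != 0 by rewrite pnatr_eq0.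
have oU := open_torus_patch hM c0 w0.
have fE (k : 'I_3) (x : M) : CP2_coord k (torus_map c0 w0 r x) =
    tvec (ratio r k) (rel_angle k (coord c0 x - w0)) (const_mx 1).
  exact: CP2_coord_torus.
split; [split|].
- exact: torus_map_inj.
- split; [exact: torus_map_continuous|exact: torus_map_open].
- move=> c d x0.
  exact: (@local_torus_smooth _ _ _ hM c0 w0 U oU torus_patch_dom
    _ (CP2_atlas R) _ d d _ (fE d)).
- move=> c d x Ux cx _ v.
  exact: (@local_torus_immersion _ _ _ hM c0 w0 U oU torus_patch_dom
    _ (CP2_atlas R) _ d d _ (fun b => ratio_neq0 d b r0) (fE d)).
- move=> c d x Ux cx _.
  apply: (@local_torus_pmc _ _ _ hM c0 w0 U oU torus_patch_dom
    _ (CP2_atlas R) _ d d _ (fun b => ratio_neq0 d b r0) (fE d)) => //.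
  + by left.
  + by rewrite expr1n.
  + exact: lt0r_neq0.
  + by apply: lt0r_neq0; rewrite ltr_pwDl// sumr_ge0// => b _; exact: sqr_ge0.
  (* For [eps = 1] a ratio must avoid 1 and -1; the radii 1, 2, 3 are distinct and positive, so this
     holds in every affine chart. *)
  + exists 0; rewrite mul1r sqrf_eq1 negb_or; apply/andP; split.
      apply/eqP => E; have /eqP : r (lift d 0) = r d.
        by rewrite -[LHS](divfK (r0 d)) [_ / _]E mul1r.
      by rewrite eqr_nat eqSS => /eqP/val_inj/eqP; rewrite eq_sym (negbTE (neq_lift _ _)).
    rewrite gt_eqF// (@lt_trans _ _ 0)// ?oppr_lt0// divr_gt0// ltr0n//.
Qed.

(** The squares of the last two radii add up to less than the square of the first. This puts the
    torus inside the ball and also makes [eps + \sum_b s b ^+ 2] nonzero for [eps = -1]. *)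
Definition ball_radii (j : 'I_3) : R := if j == ord0 then 1 else 2^-1.

Lemma torus_negative (x : M) : negative_lines (torus_map c0 w0 ball_radii x).
Proof.
have r0 j : ball_radii j != 0 by rewrite /ball_radii; case: ifP; rewrite ?invr_eq0 ?oner_eq0 ?pnatr_eq0.
rewrite /negative_lines /= /torus_map val_proj ?torus_lift_neq0// => z /vlineP[l ->] z0.
rewrite hform_torus_lift pmulr_rlt0.
  by rewrite ltcR /ball_radii /=; lra.
rewrite exprn_gt0// normr_gt0; apply: contraNneq z0 => ->; by rewrite scale0r.
Qed.

Definition ball_torus_map (x : M) : CH2 R :=
  exist (fun L : CP2 R => L \in @negative_lines R) _ (mem_set (@torus_negative x)).

Lemma CH2_torus_pmc (rho : R) : rho < 0 ->
  pmc_embedding A (CH2_atlas R) (CH2_metric rho) U ball_torus_map.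
Proof.
move=> rho0; set r := ball_radii.
have r0 j : r j != 0.
  by rewrite /r /ball_radii; case: ifP; rewrite ?invr_eq0 ?oner_eq0 ?pnatr_eq0.
have oU := open_torus_patch hM c0 w0.
have fE (x : M) : CP2_coord ord0 (torus_map c0 w0 r x) =
    tvec (ratio r ord0) (rel_angle ord0 (coord c0 x - w0)) (const_mx 1).
  exact: CP2_coord_torus.
split; [split|].
- move=> x y Ux Uy /(congr1 set_val) fxy.
  exact: (torus_map_inj hM r0 Ux Uy fxy).
(* Open sets of [CH2] are traces of open sets of [CP2], so both topological conditions are inherited
   from the projective map. *)
- split=> [x Ux|V VU oV].
    move=> W /=; rewrite nbhsE => -[_ [[W' oW' <-] W'fx] W'W].
    have nW' : nbhs (torus_map c0 w0 r x) W' by apply: open_nbhs_nbhs; split.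
    have nf : nbhs x (torus_map c0 w0 r @^-1` W').
      have cf := torus_map_continuous hM r0 Ux; exact: (cf W' nW').
    suff : nbhs x (ball_torus_map @^-1` W) by [].
    by apply: filterS nf => y Wy; exact: W'W.
  have [W oW WE] := torus_map_open hM r0 VU oV.
  exists (set_val @^-1` W); first by exists W.
  apply/seteqP; split=> [_ [x Vx <-]|L [Wx [x Ux xL]]].
    split; last by exists x => //; exact: VU.
    suff : (W `&` torus_map c0 w0 r @` U) (torus_map c0 w0 r x) by case.
    by rewrite -WE; exists x.
  rewrite -xL in Wx *; have : (torus_map c0 w0 r @` V) (torus_map c0 w0 r x).
    by rewrite WE; split; [|exists x].
  by move=> [y Vy yx]; exists y => //; exact: val_inj.
- move=> c d x0.
  exact: (@local_torus_smooth _ _ _ hM c0 w0 U oU torus_patch_dom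
    _ (CH2_atlas R) ball_torus_map d ord0 _ fE).
- move=> c d x Ux cx _ v.
  exact: (@local_torus_immersion _ _ _ hM c0 w0 U oU torus_patch_dom
    _ (CH2_atlas R) ball_torus_map d ord0 _ (fun b => ratio_neq0 ord0 b r0) fE).
- move=> c d x Ux cx _.
  apply: (@local_torus_pmc _ _ _ hM c0 w0 U oU torus_patch_dom
    _ (CH2_atlas R) ball_torus_map d ord0 _ (fun b => ratio_neq0 ord0 b r0) fE) => //.
  + by right.
  + by rewrite sqrrN expr1n.
  + exact: ltr0_neq0.
  + rewrite sum2 /ratio /r /ball_radii /=; apply: ltr0_neq0; lra.
  + exists 0; rewrite /ratio /r /ball_radii /=; rewrite lt_eqF//; lra.
Qed.

End TorusEmbeddings.

Theorem mainTheorem2 (R : realType) (rhoP rhoH : R)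
    (rhoP_gt0 : 0 < rhoP) (rhoH_lt0 : rhoH < 0)
    (M : topologicalType) (A : atlas R 2 M) (hM : smooth_manifold A) (p : M) :
  exists U : set M,
    [/\ open U, U p,
        exists f : M -> CP2 R,
          pmc_embedding A (CP2_atlas R) (CP2_metric rhoP) U f &
        exists f : M -> CH2 R,
          pmc_embedding A (CH2_atlas R) (CH2_metric rhoH) U f].
Proof.
have [_ /(_ p)[c cp] _ _] := hM.
exists (torus_patch c (coord c p)); split.
- exact: open_torus_patch.
- by split=> //; exact: ballxx.
- by exists (torus_map c (coord c p) (fun j => j.+1%:R)); exact: CP2_torus_pmc.
- by exists (@ball_torus_map R M A c (coord c p)); exact: CH2_torus_pmc.
Qed.
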